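(* Let $F$ be a probability distribution function on $\mathbb{R}$ with finite mean $\mu$, and suppose that its residual distribution $\tilde F$ has finite variance. Then there exist random variables $X_i\sim F$, $i\in\mathbb{N}$, and $Z\sim\tilde F$ such that for all $n\in\mathbb{N}$, with $S_n=X_1+\cdots+X_n$, $$\mathrm{Var}(S_n)\le \tfrac14\,\mathbb{E}[Z^2],$$ and, for this same sequence $(X_i,\,i\in\mathbb{N})$, the following hold: (a) $\mathrm{Var}(S_n)\le (b-a)^2/4$ for all $n$ if $F$ is supported on $[a,b]$, $a,b\in\mathbb{R}$; (b) $\mathrm{Var}(S_n)\le C$ for all $n$, for some constant $C$ that does not depend on $n$, if $F$ has finite third moment; (c) the sequence $(X_i,\,i\in\mathbb{N})$ is strongly extremely negatively dependent (SEND) if $\mathrm{Var}(X_1)=\mathbb{E}[Z^2]/4$.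
   Context: All random variables are defined on a common atomless probability space $(\Omega,\mathcal A,\mathbb P)$, on which independent random vectors with any distributions can be generated. $X\sim F$ means that $X$ has distribution function $F$. Generalized inverse: $F^{-1}(t)=\inf\{x:F(x)\ge t\}$ for $t\in(0,1]$ and $F^{-1}(0)=\inf\{x:F(x)>0\}$. Residual distribution $\tilde F$ of a distribution $F$ with finite mean $\mu$: let $H(s)=\int_0^s (F^{-1}(t)-\mu)\,dt$ for $s\in[0,1]$, $\nu=F(\mu-)$ (left limit), $\nu^+=F(\mu)$. The function $H$ is strictly decreasing on $[0,\nu]$, strictly increasing on $[\nu^+,1]$, $H(0)=H(1)=0$, and its minimum is $c:=H(\nu)=H(\nu^+)$. For $s\in(c,0]$ let $A(s)\in[0,\nu)$ and $B(s)\in(\nu^+,1]$ be the points with $H(A(s))=s$ and $H(B(s))=s$; let $A(c)=B(c)=\nu^+$. Let $K(s)=1$ for $s>0$, $K(s)=B(s)-A(s)$ for $c<s\le 0$, $K(c)=\nu^+-\nu$, and $K(s)=0$ for $s<c$; $K$ is a distribution function on $[c,0]$. The residual distribution $\tilde F$ is the distribution of the random variable $F^{-1}(B(Y))-F^{-1}(A(Y))$, where $Y\sim K$. A sequence $(X_i,\,i\in\mathbb{N})$ with common distribution $F$ is strongly extremely negatively dependent (SEND) if, with $S_n=X_1+\cdots+X_n$: (c1) $\mathrm{Var}(S_n)$, $n\in\mathbb{N}$, are bounded by a constant; (c2) $(S_n-n\mu)/k_n\to 0$ a.s. for any $k_n\to\infty$ as $n\to\infty$; and $\sup_{n\in\mathbb{N}}\mathrm{Var}(S_n)\le\sup_{n\in\mathbb{N}}\mathrm{Var}(Y_1+\cdots+Y_n)$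 for any sequence of random variables $(Y_i,\,i\in\mathbb{N})$ with common distribution $F$. *)

(* Defs.v *)
From HB Require Import structures.
From mathcomp Require Import all_boot all_order all_algebra.
From mathcomp Require Import all_classical all_reals all_analysis.
Set Implicit Arguments.
Unset Strict Implicit.
Unset Printing Implicit Defensive.
Import Order.TTheory GRing.Theory Num.Theory.
Import numFieldNormedType.Exports.

Local Open Scope classical_set_scope.
Local Open Scope ring_scope.

Section probability_space.
Context d (T : measurableType d) (R : realType) (P : probability T R).

Definition atomless := forall A : set T, measurable A -> (0 < P A)%E ->
  exists B : set T, [/\ measurable B, B `<=` A, (0 < P B)%E & (P B < P A)%E].

(* Taking A i := setT for some of the i gives the product rule for the
   subfamilies. *)
Definition independent_vectors (n : nat) (m : 'I_n -> nat)
    (V : forall i, T -> (m i).-tuple (measurableTypeR R)) :=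
  forall A : forall i, set ((m i).-tuple (measurableTypeR R)),
    (forall i, measurable (A i)) ->
    P (\bigcap_(i in [set: 'I_n]) (V i @^-1` A i)) =
    (\prod_(i < n) P (V i @^-1` A i))%E.

Definition generates_independent_vectors :=
  forall (n : nat) (m : 'I_n -> nat)
    (Q : forall i, probability ((m i).-tuple (measurableTypeR R)) R),
  exists V : forall i, T -> (m i).-tuple (measurableTypeR R),
    [/\ forall i, measurable_fun setT (V i),
        forall i A, measurable A -> P (V i @^-1` A) = Q i A &
        independent_vectors V].

Definition has_df (X : {RV P >-> R}) (G : R -> R) :=
  forall x, cdf X x = (G x)%:E.

Definition partial_sum (X : nat -> {RV P >-> R}) (n : nat) : T -> R :=
  fun w => \sum_(i < n) X i w.

End probability_space.

Section residual_distribution.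
Context (R : realType).

(* The probability measure with distribution function G; a default value if G
   is not a distribution function. *)
Definition law_of_df (G : R -> R) : probability (measurableTypeR R) R :=
  if pselect (exists Q : probability (measurableTypeR R) R,
                forall x, Q `]-oo, x]%classic = (G x)%:E) is left h
  then projT1 (cid h) else \d_(0 : measurableTypeR R).

Lemma law_of_dfE (G : cumulativeBounded (0 : R) 1) (x : R) :
  law_of_df G `]-oo, x]%classic = (G x)%:E.
Proof.
rewrite /law_of_df; case: pselect => [h|]; first exact: (projT2 (cid h)).
case; exists (lebesgue_stieltjes_measure G) => y.
by rewrite -cdf_lebesgue_stieltjes_id /cdf /distribution /pushforward preimage_id.
Qed.

Variable F : cumulativeBounded (0 : R) 1.

Definition has_finite_mean :=
  (lebesgue_stieltjes_measure F).-integrable setT (fun x : R => x%:E).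

Definition mean : R := \int[lebesgue_stieltjes_measure F]_x x.

(* Extended-real valued, since quantile 0 = -oo and quantile 1 = +oo when the
   support of F is unbounded below, resp. above. *)
Definition quantile (t : R) : \bar R :=
  if t == 0 then ereal_inf [set x%:E | x in [set x | 0 < F x]]
  else ereal_inf [set x%:E | x in [set x | t <= F x]].

Definition res_H (s : R) : R :=
  fine (\int[lebesgue_measure]_(t in `[0%R, s]) (quantile t - mean%:E))%E.

Definition res_nu : R := lim (F x @[x --> mean^'-]).

Definition res_nup : R := F mean.

Definition res_c : R := res_H res_nu.

Definition res_A (s : R) : R :=
  if s == res_c then res_nup else xget 0 [set t | 0 <= t < res_nu /\ res_H t = s].

Definition res_B (s : R) : R :=
  if s == res_c then res_nup else xget 0 [set t | res_nup < t <= 1 /\ res_H t = s].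

(* When F is a point mass, res_c = 0 and the third branch gives res_K 0 = 1. *)
Definition res_K (s : R) : R :=
  if 0 < s then 1 else
  if res_c < s then res_B s - res_A s else
  if s == res_c then res_nup - res_nu else 0.

(* Infinite only where res_A y = 0 or res_B y = 1, i.e. at y = 0, which is a
   null set for res_K if res_c < 0. *)
Definition residual_gap (y : R) : \bar R := (quantile (res_B y) - quantile (res_A y))%E.

Definition residual_df (z : R) : R :=
  fine (law_of_df res_K [set y | (residual_gap y <= z%:E)%E]).

End residual_distribution.

Definition SEND d (T : measurableType d) (R : realType) (P : probability T R)
    (F : cumulativeBounded (0 : R) 1) (X : nat -> {RV P >-> R}) :=
  [/\ forall i, has_df (X i) F,
      exists C : R, forall n, ('V_P[partial_sum X n] <= C%:E)%E,
      forall k : nat -> R, k n @[n --> \oo] --> +oo ->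
        {ae P, forall w,
          (partial_sum X n w - n%:R * mean F) / k n @[n --> \oo] --> (0 : R)} &
      forall Y : nat -> {RV P >-> R}, (forall i, has_df (Y i) F) ->
        (ereal_sup (range (fun n => 'V_P[partial_sum X n])) <=
         ereal_sup (range (fun n => 'V_P[partial_sum Y n])))%E].

(* Main.v *)
Require Import Defs.
From HB Require Import structures.
From mathcomp Require Import all_boot all_order all_algebra.
From mathcomp Require Import all_classical all_reals all_analysis.
From mathcomp Require Import measurable_realfun.
From mathcomp Require Import ring lra.
Set Implicit Arguments.
Unset Strict Implicit.
Unset Printing Implicit Defensive.
Import Order.TTheory GRing.Theory Num.Theory.
Import numFieldNormedType.Exports.
Local Open Scope classical_set_scope.
Local Open Scope ring_scope.

(** Let q be the quantile function of F, mu its mean, H(s) the integral of q - mu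
over [0, s], and let V, U be independent and uniform on [0, 1].  Then Y = H(V) has
distribution function K.  Given Y = y, put alpha = q(A(y)) <= mu <= q(B(y)) = beta,
p = (mu - alpha) / (beta - alpha), and
    X_i = alpha + (beta - alpha) (floor(U + (i+1) p) - floor(U + i p)),
a rotation sequence which takes the value beta with conditional probability p.
The sum telescopes: S_n - n mu = (beta - alpha) (floor(U + n p) - floor U - n p), so
with Z = beta - alpha we get |S_n - n mu| <= Z, and the conditional variance is
Z^2 {np} (1 - {np}) <= Z^2 / 4.

That X_i ~ F rests on one identity: H carries both the measure (mu - q(t)) dt on
]0, nu[ and the measure (q(t) - mu) dt on ]nup, 1[ to Lebesgue measure on ]c, 0[.
Hence the mass p that a point of ]0, nu[ sends to beta compensates the mass 1 - p
that the conjugate point of ]nup, 1[ sends to alpha. *)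

(** * Measures on the real line *)

(** The quantile function may have jumps and flat pieces, so the change of variables along H is not
    done with derivatives of [A] and [B]. Only the mass of rays is computed: for s in ]c, 0[ the
    sublevel set of H at s is [A(s), B(s)], up to endpoints, and since H is a primitive of q - mu
    both measures give it the mass s - c. Finite measures that agree on rays agree, and the layer
    cake formula passes from measures to integrals.

    The law of X_i then needs no conditional distributions. For almost every v, the two-point
    mixture attached to H(v) and the indicator at q(v) differ by explicit terms with a factor mu -
    q(v) or q(v) - mu, divided by beta - alpha. Integrated over v these terms cancel; the quotients
    are probabilities, so everything stays finite even if q is unbounded.

    Optimality in (c) comes from n = 1: Var(Y_1) depends on F only, so every competitor already
    reaches Var(X_1), which is then the common upper bound for the constructed sequence. *)

Lemma eq_measure_rays (R : realType)
    (m1 m2 : {measure set (measurableTypeR R) -> \bar R}) :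
  (m1 setT < +oo)%E -> m1 setT = m2 setT ->
  (forall x, m1 `]-oo, x]%classic = m2 `]-oo, x]%classic) ->
  forall A, measurable A -> m1 A = m2 A.
Proof.
move=> m1oo m12T m12 A mA.
pose G := @RGenOInfty.G R.
pose g (k : nat) : set R := `](- k%:R)%R, +oo[%classic.
have mG : @measurable _ (measurableTypeR R) = <<s G >>.
  exact: RGenOInfty.measurableE.
apply: (@measure_unique _ _ (measurableTypeR R) G g mG) => //.
- move=> _ _ [x ->] [y ->]; exists (Num.max x y); apply/seteqP; split => z /=;
    by rewrite !in_itv/= !andbT gt_max => /andP.
- by move=> i; exists (- i%:R).
- rewrite -subTset => x _; exists (Num.bound x) => //=.
  by rewrite /g/= in_itv/= andbT ltrNl unstable.ltrNbound.
- move=> _ [x ->].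
  (* The generators are right rays; their mass is the total mass minus that of a left ray, and
     finiteness makes the difference meaningful. *)
  have -> : `]x, +oo[%classic = [set: measurableTypeR R] `\` `]-oo, x]%classic.
    by rewrite setTD setCitvl.
  have mx : @measurable _ (measurableTypeR R) `]-oo, x]%classic.
    exact: measurable_itv.
  have m2oo : (m2 setT < +oo)%E by rewrite -m12T.
  rewrite !measureD// !setTI.
  exact: (f_equal2 (fun a b : \bar R => (a - b)%E) m12T (m12 x)).
- move=> k; apply: le_lt_trans m1oo; apply: le_measure; rewrite ?inE//.
  exact: measurable_itv.
Qed.

(** Monotonicity makes preimages of right rays intervals. It is asked on an interval only, because
    the functions concerned take default values elsewhere. *)
Lemma nondecreasing_in_measurable (R : realType) (D : interval R) (f : R -> R) :
  {in D &, {homo f : x y / x <= y}} -> measurable_fun [set` D] f.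
Proof.
move=> f_nd mD; apply: (measurability _ (RGenCInfty.measurableE R)) => //.
move=> _ [_] [r ->] <-; apply: is_interval_measurable => s t /=.
move=> -[Ds fs] [Dt ft] u /andP[su ut].
have Du : u \in D := @interval_is_interval R D s t Ds Dt u (introT andP (conj su ut)).
split=> //; move: fs; rewrite /= !in_itv/= !andbT => /le_trans; apply.
exact: f_nd.
Qed.

Lemma nonincreasing_in_measurable (R : realType) (D : interval R) (f : R -> R) :
  {in D &, {homo f : x y / x <= y >-> y <= x}} -> measurable_fun [set` D] f.
Proof.
move=> f_ni; rewrite -(opprK f); apply/measurable_funN.
by apply: nondecreasing_in_measurable => x y Dx Dy xy; rewrite lerN2 f_ni.
Qed.

Section real_line.
Variable R : realType.
Implicit Types (a b x : R) (S : set R).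
Local Notation leb := (@lebesgue_measure R).

Lemma measurable_if_itv (a b : R) (f g : R -> R) :
  measurable_fun (`]a, b[ : set R) f -> measurable_fun setT g ->
  measurable_fun setT (fun x => if a < x < b then f x else g x).
Proof.
move=> mf mg.
rewrite (_ : (fun _ => _) = (fun x => g x + ((fun x => f x - g x) \_ `]a, b[) x)).
  apply: measurable_funD => //; apply/(measurable_restrictT _ _).1 => //.
  by apply: measurable_funB => //; exact: measurable_funTS.
apply/funext => x; rewrite patchE mem_setE in_itv/=; case: ifPn => _.
  by rewrite addrC subrK.
by rewrite addr0.
Qed.

Lemma integral_if_itv (a b : R) (f : R -> R) (S : set R) :
  (\int[leb]_(t in S) (if (a < t < b)%R then f t else 0%R)%:E =
   \int[leb]_(t in S `&` `]a, b[) (f t)%:E)%E.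
Proof.
rewrite integral_mkcondr; apply: eq_integral => t _.
by rewrite patchE mem_setE in_itv/=; case: ifP.
Qed.

Lemma lebesgue_sub_itv (S : set R) a b : a <= b ->
  measurable S -> `]a, b[%classic `<=` S -> S `<=` `[a, b]%classic ->
  leb S = (b - a)%:E.
Proof.
move=> ab mS abS Sab.
have E (b0 b1 : bool) : leb [set` Interval (BSide b0 a) (BSide b1 b)] = (b - a)%:E.
  rewrite lebesgue_measure_itv/= lte_fin; move: ab.
  by case: ltgtP => // -> _; rewrite subrr.
apply/le_anti/andP; split.
  by rewrite -(E true false); apply: le_measure; rewrite ?inE.
by rewrite -(E false true); apply: le_measure; rewrite ?inE.
Qed.

(** Meant for the points [nu] and [nup], at which the pointwise identities below are not claimed. *)
Lemma ae_lebesgue_except2 a b (Q : R -> Prop) :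
  (forall v, v != a -> v != b -> Q v) -> {ae leb, forall v, Q v}.
Proof.
move=> abQ; exists [set a; b]; split.
- exact: measurableU.
- apply: countable_lebesgue_measure0; apply: finite_set_countable.
  exact: finite_set2.
- move=> v /= nQ; apply: contrapT => /not_orP[/eqP va /eqP vb].
  exact/nQ/abQ.
Qed.

Lemma lebesgue_eq_except2 a b (S1 S2 : set R) :
  measurable S1 -> measurable S2 ->
  (forall v, v != a -> v != b -> S1 v <-> S2 v) -> leb S1 = leb S2.
Proof.
move=> mS1 mS2 S12; rewrite -(setIT S1) -(setIT S2) -!integral_indic//.
apply: ge0_ae_eq_integral => //.
- exact/measurable_EFinP/measurable_indic.
- exact/measurable_EFinP/measurable_indic.
apply: (ae_lebesgue_except2 (a := a) (b := b)) => v va vb _.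
rewrite !indicE; congr (_%:R)%:E.
by congr nat_of_bool; apply/idP/idP; rewrite !inE => /(S12 v va vb).
Qed.

End real_line.

(** * Change of variables for two densities under a common map *)

Section density.
Context {R : realType}.
Implicit Types (f g H : R -> R).
Local Notation leb := (@lebesgue_measure R).

(** The image under [H] of the measure with density [f]. The side conditions are arguments so that
    the measure structure can be attached to this function. *)
Definition density_image f H of measurable_fun setT f & (forall t, 0 <= f t) &
    measurable_fun setT H :=
  fun S : set (measurableTypeR R) => (\int[leb]_(t in H @^-1` S) (f t)%:E)%E.

Section density_image.
Variables (f H : R -> R) (mf : measurable_fun setT f) (f0 : forall t, 0 <= f t)
  (mH : measurable_fun setT H).
Local Notation m := (density_image mf f0 mH).

Let m_set0 : m set0 = 0%E.
Proof. by rewrite /m preimage_set0 integral_set0. Qed.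

Let m_ge0 S : (0 <= m S)%E.
Proof. by apply: integral_ge0 => t _; rewrite lee_fin. Qed.

Let m_sigma_additive : semi_sigma_additive m.
Proof.
move=> S mS tS mUS; rewrite /density_image; apply: cvg_toP.
  apply: ereal_nondecreasing_is_cvgn => i j ij.
  by apply: lee_sum_nneg_natr => // k _ _; exact: m_ge0.
rewrite preimage_bigcup ge0_integral_bigcup//=.
- by move=> k; rewrite -[X in measurable X]setTI; apply: mH => //; exact: mS.
- exact/measurable_EFinP/measurable_funTS.
- by move=> t _; rewrite lee_fin.
- by move: tS; rewrite !trivIsetP => tS i j _ _ ij; rewrite -preimage_setI tS// preimage_set0.
Qed.

HB.instance Definition _ := isMeasure.Build _ _ _ m m_set0 m_ge0
  m_sigma_additive.

End density_image.

Lemma measurable_ltpair g : measurable_fun setT g ->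
  measurable [set z : measurableTypeR R * measurableTypeR R | 0 <= z.2 < g z.1].
Proof.
move=> mg; rewrite -[X in measurable X]setTI.
apply: (measurable_and _ _ measurableT (Y := [set true])) => //.
- exact: measurable_fun_ler.
- apply: measurable_fun_ltr => //; exact: (measurableT_comp mg measurable_fst).
Qed.

Lemma integral_cst_itv0 (c k : R) : 0 <= c -> 0 <= k ->
  (\int[leb]_r (k * \1_`[0%R, c[ r)%:E = (c * k)%:E)%E.
Proof.
move=> c0 k0; under eq_integral do rewrite EFinM.
rewrite ge0_integralZl_EFin//; last first.
  exact/measurable_EFinP/measurable_indic.
have mc : (leb `[0%R, c[%classic = c%:E)%E.
  rewrite lebesgue_measure_itv/= lte_fin.
  by case: ltP => [_|/(conj c0)/andP/le_anti <-//]; rewrite sube0.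
rewrite integral_indic// setIT.
by transitivity (k%:E * c%:E)%E; [congr (_ * _)%E | rewrite -EFinM mulrC].
Qed.

(* Layer cake: [g (H t) * f t] is the integral of [f t] over [0 <= r < g (H t)],
   and integrating over [t] first leaves the mass that the image of the density
   [f] under [H] gives to [g > r]. *)
Lemma integral_density_layer_cake f g H (mf : measurable_fun setT f)
    (f0 : forall t, 0 <= f t) (mH : measurable_fun setT H) :
  measurable_fun setT g -> (forall y, 0 <= g y) ->
  (\int[leb]_t (g (H t) * f t)%:E =
   \int[leb]_(r in `[0%R, +oo[) density_image mf f0 mH [set y | (r < g y)%R])%E.
Proof.
move=> mg g0.
have mgH : measurable_fun setT (g \o H) by exact: measurableT_comp.
pose A := [set z : measurableTypeR R * measurableTypeR R | 0 <= z.2 < g (H z.1)].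
have mA : measurable A by exact: (measurable_ltpair mgH).
pose F (z : measurableTypeR R * measurableTypeR R) := ((f z.1 * \1_A z)%:E : \bar R).
have mF : measurable_fun setT F.
  apply/measurable_EFinP/measurable_funM.
    exact: (measurableT_comp mf measurable_fst).
  exact: measurable_indic.
have F0 z : (0 <= F z)%E by rewrite lee_fin mulr_ge0.
have -> : (\int[leb]_t (g (H t) * f t)%:E = \int[leb]_t \int[leb]_r F (t, r))%E.
  apply: eq_integral => t _; etransitivity.
    exact/esym/(integral_cst_itv0 (g0 (H t)) (f0 t)).
  by apply: eq_integral => r _; rewrite /F !indicE; congr (_ * _%:R)%:E;
    apply/idP/idP; rewrite !inE /A/= in_itv.
rewrite (@fubini_tonelli _ _ _ _ R leb leb F mF F0).
rewrite [RHS]integral_mkcond; apply: eq_integral => r _.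
rewrite patchE; case: ifPn => r0; last first.
  rewrite integral0_eq// => t _; rewrite /F indicE memNset ?mulr0// /A/=.
  by move: r0; rewrite notin_setE/= in_itv/= andbT => /negP/negbTE ->.
rewrite /density_image [RHS]integral_mkcond; apply: eq_integral => t _.
rewrite /F patchE; case: ifPn => /=.
  move=> /set_mem /= rg; rewrite indicE mem_set ?mulr1// /A/= rg andbT.
  by move: r0; rewrite inE/= in_itv/= andbT.
rewrite notin_setE/= => rg; rewrite indicE memNset ?mulr0// /A/=.
by move=> /andP[_].
Qed.

(** By the layer cake formula both sides depend only on the images of [f1] and [f2] under [H]. These
    are finite measures of equal mass that agree on rays, so neither injectivity nor smoothness of
    [H] enters. *)
Lemma integral_density_rays f1 f2 H : measurable_fun setT H ->
  measurable_fun setT f1 -> measurable_fun setT f2 ->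
  (forall t, 0 <= f1 t) -> (forall t, 0 <= f2 t) ->
  (\int[leb]_t (f1 t)%:E < +oo)%E ->
  (\int[leb]_t (f1 t)%:E = \int[leb]_t (f2 t)%:E)%E ->
  (forall s, \int[leb]_(t in H @^-1` `]-oo, s]) (f1 t)%:E =
             \int[leb]_(t in H @^-1` `]-oo, s]) (f2 t)%:E)%E ->
  forall g, measurable_fun setT g -> (forall y, 0 <= g y) ->
  (\int[leb]_t (g (H t) * f1 t)%:E = \int[leb]_t (g (H t) * f2 t)%:E)%E.
Proof.
move=> mH mf1 mf2 f10 f20 f1oo f12T f12 g mg g0.
rewrite (integral_density_layer_cake mf1 f10 mH)//.
rewrite (integral_density_layer_cake mf2 f20 mH)//.
apply: eq_integral => r _; apply: eq_measure_rays => //.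
rewrite -[X in measurable X]setTI.
by apply: (measurable_fun_ltr _ _ measurableT (Y := [set true])).
Qed.

(** With [k] the floor and [r] the fractional part of [x], the floor of [u + x] is [k] for [u] in
    [0, 1 - r[ and [k + 1] for [u] in [1 - r, 1[. *)
Lemma integral_floor_shift (phi : int -> R) (x : R) : (forall z, 0 <= phi z) ->
  (\int[leb]_(u in `[0%R, 1%R[) (phi (Num.floor (u + x)))%:E =
  ((1 - (x - (Num.floor x)%:~R)) * phi (Num.floor x) +
   (x - (Num.floor x)%:~R) * phi (Num.floor x + 1)%R)%:E)%E.
Proof.
move=> phi0; set k := Num.floor x; set r := x - k%:~R.
have := floor_itv x; rewrite -/k => /andP[kx xk1].
have r0 : 0 <= r by rewrite subr_ge0.
have r1 : r < 1 by rewrite /r; move: xk1; rewrite intrD; lra.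
have phiE1 u : u \in `[0, 1 - r[ -> phi (Num.floor (u + x)) = phi k.
  rewrite in_itv/= => /andP[u0 u1]; congr phi.
  apply/floor_def; rewrite intrD; apply/andP; split; rewrite /r in u1; lra.
have phiE2 u : u \in `[1 - r, 1[ -> phi (Num.floor (u + x)) = phi (k + 1).
  rewrite in_itv/= => /andP[u0 u1]; congr phi.
  apply/floor_def; rewrite !intrD; apply/andP; split; rewrite /r in u0; lra.
rewrite (@itv_bndbnd_setU _ _ _ (BLeft (1 - r)))// ?bnd_simp; [|lra..].
rewrite ge0_integral_setU//=; last 3 first.
- apply/measurable_funU => //; split.
    apply: (eq_measurable_fun (cst (phi k)%:E)) => // u; rewrite inE => /phiE1 ->//.
  apply: (eq_measurable_fun (cst (phi (k + 1))%:E)) => // u; rewrite inE => /phiE2 ->//.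
- by move=> u _; rewrite lee_fin.
- apply/disj_setPS => u [/=]; rewrite !in_itv/=; lra.
rewrite (eq_integral (cst (phi k)%:E)); last first.
  by move=> u; rewrite inE => /phiE1 ->.
rewrite [X in (_ + X)%E](eq_integral (cst (phi (k + 1))%:E)); last first.
  by move=> u; rewrite inE => /phiE2 ->.
rewrite !integral_cst//= !lebesgue_measure_itv/= !lte_fin.
rewrite ifT; last by lra.
(* The second interval is empty exactly when [x] is an integer, that is when [r = 0]. *)
case: ltP => h; rewrite -!EFinM -?EFinD.
  by congr EFin; ring.
congr EFin; have -> : r = 0 by lra.
by ring.
Qed.

End density.

(** * Random variables whose law is known on rays *)

Section law.
Context d (T : measurableType d) (R : realType).
Variables (P : {measure set T -> \bar R}) (X : T -> R)
  (m : {measure set (measurableTypeR R) -> \bar R}).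
Hypotheses (mX : measurable_fun setT X) (mT : P setT = m setT)
  (PT : (P setT < +oo)%E)
  (mray : forall x, P (X @^-1` `]-oo, x]) = m `]-oo, x]%classic).

Let mX' : measurable_fun setT (X : T -> measurableTypeR R).
Proof. exact: mX. Qed.

Let X' : {mfun T >-> measurableTypeR R} :=
  HB.pack (X : T -> measurableTypeR R) (isMeasurableFun.Build _ _ _ _ _ mX').

Lemma law_preimage A : measurable A -> P (X @^-1` A) = m A.
Proof.
move=> mA; apply: (@eq_measure_rays R (pushforward P X') m) => //.
Qed.

Lemma ge0_integral_law g : measurable_fun setT g -> (forall x, 0 <= g x)%E ->
  (\int[P]_w g (X w) = \int[m]_x g x)%E.
Proof.
move=> mg g0.
transitivity (\int[pushforward P X']_x g x)%E.
  by rewrite [RHS]ge0_integral_pushforward.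
by apply: eq_measure_integral => A mA _; exact: law_preimage.
Qed.

End law.

(** * The quantile function and the integral of its excess over the mean *)

Lemma integral_uniform01 (R : realType) (f : R -> \bar R) :
  measurable_fun setT f -> (forall x, 0 <= f x)%E ->
  (\int[uniform_prob (@ltr01 R)]_x f x =
   \int[lebesgue_measure]_(x in `]0%R, 1%R[) f x)%E.
Proof.
move=> mf f0; rewrite integral_uniform//.
rewrite subr0 invr1 mul1e integral_itv_bndoo//.
exact: measurable_funTS.
Qed.

Lemma uniform01E (R : realType) (S : set R) : measurable S ->
  uniform_prob (@ltr01 R) S = lebesgue_measure (`]0, 1[ `&` S).
Proof.
move=> mS; have mS1 : measurable_fun setT (EFin \o (\1_S : R -> R)).
  exact/measurable_EFinP/measurable_indic.
transitivity (\int[uniform_prob (@ltr01 R)]_x (\1_S x)%:E)%E.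
  by rewrite integral_indic// setIT.
rewrite (integral_uniform01 mS1)//; last by move=> x; rewrite lee_fin.
by rewrite integral_indic// setIC.
Qed.

Section quantile.
Variables (R : realType) (F : cumulativeBounded (0 : R) 1).
Implicit Types t x y : R.
Local Notation leb := (@lebesgue_measure R).
Local Notation lsf := (lebesgue_stieltjes_measure F).

(** Faithful to [quantile] on ]0, 1[, where the latter is finite; at 0 and 1 an infinite value is
    replaced by the default of [fine]. *)
Definition rquantile t := fine (quantile F t).
Local Notation q := rquantile.

Lemma df_nd : {homo F : x y / x <= y}.
Proof. exact: cumulative_is_nondecreasing. Qed.

Lemma lebesgue_stieltjesNyc x : lsf `]-oo, x]%classic = (F x)%:E.
Proof. by rewrite -cdf_lebesgue_stieltjes_id /cdf /distribution /pushforward preimage_id. Qed.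

Lemma df_ge0 x : 0 <= F x.
Proof. by rewrite -lee_fin -lebesgue_stieltjesNyc measure_ge0. Qed.

Lemma df_le1 x : F x <= 1.
Proof. by rewrite -lee_fin -lebesgue_stieltjesNyc probability_le1. Qed.

Lemma df_lt_ex t : 0 < t -> exists x, F x < t.
Proof.
by move=> t0; have /cvgr_lt/(_ t t0)/filter_ex := cumulativeNy F.
Qed.

Lemma df_gt_ex t : t < 1 -> exists x, t < F x.
Proof.
by move=> t1; have /cvgr_gt/(_ t t1)/filter_ex := cumulativey F.
Qed.

(** Right continuity is the point: if [F x < t], then [F] stays below [t] slightly to the right of
    [x], so the infimum is larger than [x]. The value at 0 has its own definition and is
    excluded. *)
Lemma quantile_le t x : t != 0 -> (quantile F t <= x%:E)%E = (t <= F x).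
Proof.
move=> t0; rewrite /quantile (negbTE t0); apply/idP/idP => [|tFx]; last first.
  by apply: ereal_inf_lbound; exists x.
apply: contraTT; rewrite -!ltNge => Fxt.
have /cvgr_lt/(_ t Fxt) Ft := @cumulative_is_right_continuous _ _ _ F x.
have /filter_ex[y [Fyt xy]] : \forall y \near x^'+, F y < t /\ x < y.
  by near=> y; split; near: y => //; exact: nbhs_right_gt.
apply: (@lt_le_trans _ _ y%:E); first by rewrite lte_fin.
apply: le_ereal_inf_tmp => _ [z tFz <-]; rewrite lee_fin leNgt.
apply: contraTN tFz => zy /=; rewrite -ltNge (le_lt_trans _ Fyt)//.
exact/df_nd/ltW.
Unshelve. all: by end_near. Qed.

Lemma quantile_fin_num t x : 0 < t -> t <= F x -> quantile F t \is a fin_num.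
Proof.
move=> t0 tFx; have tn0 : t != 0 by rewrite gt_eqF.
have [y Fyt] := df_lt_ex t0.
rewrite fin_numElt (@lt_trans _ _ y%:E) ?ltNyr//=; last first.
  by rewrite ltNge quantile_le// -ltNge.
by rewrite (@le_lt_trans _ _ x%:E) ?ltry// quantile_le.
Qed.

Lemma quantileE t : 0 < t < 1 -> quantile F t = (q t)%:E.
Proof.
move=> /andP[t0 t1]; have [x /ltW Fx] := df_gt_ex t1.
by rewrite fineK// (quantile_fin_num t0 Fx).
Qed.

Lemma rquantile_le t x : 0 < t < 1 -> (q t <= x) = (t <= F x).
Proof.
by move=> t01; rewrite -lee_fin -quantileE// quantile_le// gt_eqF//; case/andP: t01.
Qed.

Lemma rquantile_nd : {in `]0, 1[ &, {homo q : s t / s <= t}}.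
Proof.
move=> s t; rewrite !in_itv/= => s01 t01 st.
by rewrite rquantile_le// (le_trans st)// -rquantile_le.
Qed.

Lemma measurable_rquantile : measurable_fun (`]0, 1[ : set R) q.
Proof. by apply: nondecreasing_in_measurable; exact: rquantile_nd. Qed.

(** Quantile transform: on ]0, 1[ the event [q t <= x] is [t <= F x], of length [F x], so [q] of a
    uniform variable has distribution function [F]. The case [F x = 1] is separate because the event
    is then the whole open interval. *)
Lemma integral_rquantile (g : R -> \bar R) :
  measurable_fun setT g -> (forall x, 0 <= g x)%E ->
  (\int[lsf]_x g x = \int[leb]_(t in `]0%R, 1%R[) g (q t))%E.
Proof.
move=> mg g0.
pose q1 := q \_ `]0, 1[.
have mq1 : measurable_fun setT q1.
  by apply/(measurable_restrictT _ _).1 => //; exact: measurable_rquantile.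
have q1E t : t \in `]0, 1[ -> q1 t = q t.
  by move=> t01; rewrite /q1 patchE ifT// inE.
have rays x : uniform_prob (@ltr01 R) (q1 @^-1` `]-oo, x]) = lsf `]-oo, x]%classic.
  have mx : measurable (q1 @^-1` `]-oo, x]).
    by rewrite -[X in measurable X]setTI; apply: mq1 => //; exact: measurable_itv.
  rewrite uniform01E// lebesgue_stieltjesNyc.
  have [Fx1|Fx1] := ltP (F x) 1.
    rewrite (_ : _ `&` _ = `]0, F x]%classic).
      rewrite lebesgue_measure_itv/= lte_fin.
      have := df_ge0 x; case: ltgtP => // [_ _|<-//]; by rewrite sube0.
    apply/seteqP; split => t /=; rewrite !in_itv/=.
      by move=> [t01]; rewrite q1E ?in_itv// rquantile_le//; case/andP: t01 => ->.
    move=> /andP[t0 tF]; have t01 : 0 < t < 1 by rewrite t0 (le_lt_trans tF).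
    by rewrite q1E ?in_itv// rquantile_le.
  have Fx : F x = 1 by apply/le_anti; rewrite Fx1 df_le1.
  rewrite (_ : _ `&` _ = `]0%R, 1%R[%classic).
    by rewrite lebesgue_measure_itv/= lte_fin ltr01 sube0 Fx.
  apply/seteqP; split => t /=; rewrite !in_itv/=; first by case.
  move=> t01; split => //; rewrite q1E ?in_itv// rquantile_le// Fx.
  by case/andP: t01 => _ /ltW.
rewrite -(@ge0_integral_law _ _ R (uniform_prob (@ltr01 R)) q1 lsf)//.
- rewrite integral_uniform01//=.
  + by apply: eq_integral => t; rewrite inE/= => /q1E ->.
  + exact: measurableT_comp.
- by transitivity (1%:E : \bar R); [|apply/esym]; exact: probability_setT.
- by rewrite (le_lt_trans (probability_le1 _ _))// ltry.
Qed.

Hypothesis F_mean : has_finite_mean F.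
Local Notation mu := (mean F).

(** The transport formula [integral_rquantile] concerns nonnegative integrands, hence the split into
    positive and negative parts. *)
Lemma integral_rquantile_mean :
  (\int[leb]_(t in `]0%R, 1%R[) (q t)%:E = mu%:E)%E.
Proof.
have mE : measurable_fun [set: R] (EFin : R -> \bar R) by exact: EFin_measurable.
rewrite /mean /Rintegral fineK; last exact: integrable_fin_num.
etransitivity; first exact: integralE.
apply/esym; etransitivity; first exact: integralE.
apply/esym; congr (_ - _)%E.
rewrite (integral_rquantile (measurable_funepos mE))//.
  by apply: eq_integral => t _; rewrite !funeposE.
rewrite (integral_rquantile (measurable_funeneg mE))//.
by apply: eq_integral => t _; rewrite !funenegE.
Qed.

Lemma integrable_rquantile : leb.-integrable `]0%R, 1%R[ (EFin \o q).
Proof.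
apply/integrableP; split.
  by apply/measurable_EFinP; exact: measurable_rquantile.
have /integrableP[_] := F_mean.
rewrite (integral_rquantile (g := fun x => `|x%:E|%E))//.
exact: measurableT_comp.
Qed.

Definition excess t := q t - mu.

Lemma integrable_excess : leb.-integrable `]0%R, 1%R[ (EFin \o excess).
Proof.
rewrite (_ : EFin \o excess = ((EFin \o q) \- cst mu%:E)%E); last exact/funext.
apply: integrableB => //; first exact: integrable_rquantile.
apply/integrableP; split => //; rewrite integral_cst//= lebesgue_measure_itv/=.
by rewrite lte_fin ltr01 sube0 mule1 ltry.
Qed.

(** A real-valued form of [res_H]. The open interval avoids 0 and 1, where the quantile may be
    infinite. *)
Definition excess_int s := \int[leb]_(t in `]0, s[) excess t.
Local Notation H := excess_int.

Lemma integrable_excessS a b : 0 <= a -> b <= 1 ->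
  leb.-integrable `]a, b[ (EFin \o excess).
Proof.
move=> a0 b1; apply: integrableS integrable_excess => //.
by apply: subset_itv; rewrite bnd_simp.
Qed.

Lemma res_HE s : 0 <= s <= 1 -> res_H F s = H s.
Proof.
move=> /andP[s0 s1]; rewrite /res_H /excess_int /Rintegral; congr fine.
have E : {in `]0, s[%classic, (fun t => (quantile F t - mu%:E)%E) =1 (EFin \o excess)}.
  move=> t; rewrite inE/= in_itv/= => /andP[t0 ts].
  by rewrite quantileE ?t0 ?(lt_le_trans ts).
rewrite integral_itv_bndoo; first exact: eq_integral.
apply: (eq_measurable_fun _ (fun t ht => esym (E t ht))).
exact: (measurable_int leb (integrable_excessS (lexx 0) s1)).
Qed.

Lemma excess_int_sub s t : 0 <= s -> s <= t -> t <= 1 ->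
  H t - H s = \int[leb]_(u in `]s, t[) excess u.
Proof.
move=> s0; rewrite le_eqVlt => /predU1P[<- _|st t1].
  by rewrite subrr set_itv_ge ?Rintegral_set0// bnd_simp ltxx.
rewrite /excess_int [X in _ - X]Rintegral_itv_bndo_bndc; last first.
  by apply: integrable_excessS => //; rewrite (le_trans (ltW st)).
rewrite Rintegral_itvB// ?bnd_simp//.
exact: integrable_excessS.
Qed.

Lemma excess_int0 : H 0 = 0.
Proof. by rewrite /excess_int set_itvoo0 Rintegral_set0. Qed.

Let fine_itv (s t : R) : s <= t -> fine (leb `]s, t[%classic) = t - s.
Proof.
move=> st; rewrite lebesgue_measure_itv/= lte_fin.
by move: st; case: ltgtP => // -> _; rewrite subrr.
Qed.

Let icst (s t k : R) : leb.-integrable `]s, t[ (EFin \o cst k).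
Proof.
apply/integrableP; split; first exact/measurable_EFinP/measurable_cst.
 rewrite (eq_integral (cst `|k|%:E)%E)//.
rewrite integral_cst//= lebesgue_measure_itv/=.
by case: ifPn => _; rewrite ?mule0// -EFinB -EFinM ltry.
Qed.

Lemma excess_int1 : H 1 = 0.
Proof.
rewrite /excess_int (@RintegralB _ _ _ leb)//;
  [|exact: integrable_rquantile|exact: icst].
rewrite Rintegral_cst// (fine_itv ler01) subr0 mulr1.
by rewrite [X in X - _]/Rintegral integral_rquantile_mean subrr.
Qed.

Lemma excess_int_le s t k : 0 <= s -> s <= t -> t <= 1 ->
  {in `]s, t[, forall u, excess u <= k} -> H t - H s <= k * (t - s).
Proof.
move=> s0 st t1 uk; rewrite excess_int_sub// -(fine_itv st) -Rintegral_cst//.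
by apply: le_Rintegral => //; [exact: integrable_excessS|exact: icst].
Qed.

Lemma excess_int_ge s t k : 0 <= s -> s <= t -> t <= 1 ->
  {in `]s, t[, forall u, k <= excess u} -> k * (t - s) <= H t - H s.
Proof.
move=> s0 st t1 uk; rewrite excess_int_sub// -(fine_itv st) -Rintegral_cst//.
by apply: le_Rintegral => //; [exact: icst|exact: integrable_excessS].
Qed.

Lemma excess_int_continuous : {within `[0, 1], continuous H}.
Proof.
(* Extension by 0 gives an integrable function on the closed interval with the same primitive. *)
pose f := excess \_ `]0, 1[.
have intf : leb.-integrable `[0, 1] (EFin \o f).
  rewrite -restrict_EFin; apply/integrable_restrict => //=.
  rewrite setIidr; first exact: integrable_excess.
  by apply: subset_itv; rewrite bnd_simp.
have := parameterized_integral_continuous ler01 intf.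
apply: subspace_eq_continuous => x; rewrite inE/= in_itv/= => /andP[x0 x1].
rewrite /excess_int/= /parameterized_integral.
rewrite /from_subspace/=.
rewrite -Rintegral_itv_bndo_bndc; last first.
  by apply: integrableS intf => //; apply: subset_itv; rewrite bnd_simp.
rewrite -Rintegral_itv_obnd_cbnd; last first.
  by apply: integrableS intf => //; apply: subset_itv; rewrite bnd_simp.
apply: eq_Rintegral => u; rewrite inE/= in_itv/= => /andP[u0 ux].
by rewrite /f patchE ifT// inE/= in_itv/= u0 (lt_le_trans ux).
Qed.

End quantile.

(** * The monotone branches of the excess integral and their inverses *)

Section residual.
Variables (R : realType) (F : cumulativeBounded (0 : R) 1).
Hypothesis F_mean : has_finite_mean F.
Implicit Types s t u v x y : R.
Local Notation leb := (@lebesgue_measure R).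
Local Notation mu := (mean F).
Local Notation q := (rquantile F).
Local Notation H := (excess_int F).
Local Notation excess := (excess F).
Local Notation nu := (res_nu F).
Local Notation nup := (res_nup F).
Local Notation c := (res_c F).
Local Notation A := (res_A F).
Local Notation B := (res_B F).

Lemma is_cvg_res_nu : cvg (F x @[x --> mu^'-]).
Proof.
apply: nondecreasing_at_left_is_cvgr.
  by near=> x => y z _ _; exact: df_nd.
near=> x; exists 1 => _ [y _ <-]; exact: df_le1.
Unshelve. all: by end_near. Qed.

Lemma df_le_nu x : x < mu -> F x <= nu.
Proof.
move=> xmu; apply: limr_ge; first exact: is_cvg_res_nu.
near=> y; apply/df_nd/ltW; near: y; exact: nbhs_left_gt.
Unshelve. all: by end_near. Qed.

Lemma df_gt_nu t : t < nu -> exists2 x, x < mu & t < F x.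
Proof.
move=> tnu; have /cvgr_gt/(_ t tnu) Ft : F x @[x --> mu^'-] --> nu.
  exact: is_cvg_res_nu.
have /filter_ex[x [xmu tF]] : \forall x \near mu^'-, x < mu /\ t < F x.
  by near=> x; split; near: x => //; exact: nbhs_left_lt.
by exists x.
Unshelve. all: by end_near. Qed.

Lemma nu_ge0 : 0 <= nu.
Proof. by rewrite (le_trans (df_ge0 F (mu - 1)))// df_le_nu// gtrBl. Qed.

Lemma nu_le_nup : nu <= nup.
Proof.
apply: limr_le; first exact: is_cvg_res_nu.
near=> y; apply/df_nd/ltW; near: y; exact: nbhs_left_lt.
Unshelve. all: by end_near. Qed.

Lemma nup_le1 : nup <= 1. Proof. exact: df_le1. Qed.

Lemma excess_lt0 t : 0 < t -> t < nu -> excess t < 0.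
Proof.
move=> t0 tnu; have t1 : t < 1 by rewrite (lt_le_trans tnu)// (le_trans nu_le_nup)// nup_le1.
have [x xmu /ltW tF] := df_gt_nu tnu.
by rewrite subr_lt0 (le_lt_trans _ xmu)// rquantile_le// t0.
Qed.

Lemma excess_ge0 t : nu < t -> t < 1 -> 0 <= excess t.
Proof.
move=> nut t1; have t01 : 0 < t < 1 by rewrite t1 (le_lt_trans nu_ge0).
rewrite subr_ge0 leNgt; apply: contraTN nut => /df_le_nu qnu.
by rewrite -leNgt (le_trans _ qnu)// -rquantile_le.
Qed.

Lemma excess_le0 t : 0 < t -> t <= nup -> t < 1 -> excess t <= 0.
Proof. by move=> t0 tnup t1; rewrite subr_le0 rquantile_le// t0. Qed.

Lemma excess_gt0 t : nup < t -> t < 1 -> 0 < excess t.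
Proof.
move=> nupt t1; have t0 : 0 < t by rewrite (le_lt_trans (df_ge0 F mu)).
by rewrite subr_gt0 ltNge rquantile_le ?t0// -ltNge.
Qed.

Lemma excess_nd : {in `]0, 1[ &, {homo excess : s t / s <= t}}.
Proof. by move=> s t s01 t01 st; rewrite lerD2r rquantile_nd. Qed.

(** The excess may tend to 0 at [nu], so it need not be bounded away from 0 on ]s, t[. Up to the
    midpoint [m] it is at most [excess m < 0], which gives strictness; beyond [m] it is merely
    nonpositive. *)
Lemma excess_int_decr s t : 0 <= s -> s < t -> t <= nu -> H t < H s.
Proof.
move=> s0 st tnu; pose m := (s + t) / 2.
have t1 : t <= 1 by rewrite (le_trans tnu)// (le_trans nu_le_nup)// nup_le1.
have [sm mt] : s < m /\ m < t by rewrite /m; split; lra.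
have [sm' mt'] := (ltW sm, ltW mt).
have m0 : 0 < m by lra.
have m1 : m < 1 by lra.
have ex0 : excess m < 0 by apply: excess_lt0 => //; lra.
have h1 : H m - H s <= excess m * (m - s).
  apply: (excess_int_le F_mean s0 sm' (ltW m1)).
  move=> u; rewrite in_itv/= => /andP[su um].
  by apply: excess_nd; rewrite ?in_itv/= ?ltW//; apply/andP; split => //; lra.
have h2 : H t - H m <= 0 * (t - m).
  apply: (excess_int_le F_mean (ltW m0) mt' t1).
  move=> u; rewrite in_itv/= => /andP[mu_ ut].
  by apply/ltW/excess_lt0; lra.
have : excess m * (m - s) < 0 by rewrite nmulr_rlt0// subr_gt0.
by move: h1 h2; rewrite mul0r; lra.
Qed.

Lemma excess_int_incr s t : nup <= s -> s < t -> t <= 1 -> H s < H t.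
Proof.
move=> nups st t1; pose m := (s + t) / 2.
have s0 : 0 <= s by rewrite (le_trans (df_ge0 F mu)).
have [sm mt] : s < m /\ m < t by rewrite /m; split; lra.
have [sm' mt'] := (ltW sm, ltW mt).
have m0 : 0 < m by lra.
have m1 : m < 1 by lra.
have ex0 : 0 < excess m by apply: excess_gt0 => //; rewrite (le_lt_trans nups).
have h1 : excess m * (t - m) <= H t - H m.
  apply: (excess_int_ge F_mean (ltW m0) mt' t1).
  move=> u; rewrite in_itv/= => /andP[mu_ ut].
  by apply: excess_nd; rewrite ?in_itv/= ?ltW//; apply/andP; split => //; lra.
have h2 : 0 * (m - s) <= H m - H s.
  apply: (excess_int_ge F_mean s0 sm' (ltW m1)).
  move=> u; rewrite in_itv/= => /andP[su um].
  by apply/ltW/excess_gt0; [rewrite (le_lt_trans nups)|lra].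
have h3 : 0 < excess m * (t - m) by apply: (mulr_gt0 ex0); rewrite subr_gt0.
by rewrite mul0r in h2; lra.
Qed.

Lemma excess_int_cst s t : nu <= s -> s <= t -> t <= nup -> H s = H t.
Proof.
move=> nus st tnup; have nu0 := nu_ge0; have nup1 := nup_le1.
have h1 : H t - H s <= 0 * (t - s).
  apply: (excess_int_le F_mean) => //; [lra|lra|].
  by move=> u; rewrite in_itv/= => /andP[su ut]; apply: excess_le0; lra.
have h2 : 0 * (t - s) <= H t - H s.
  apply: (excess_int_ge F_mean) => //; [lra|lra|].
  by move=> u; rewrite in_itv/= => /andP[su ut]; apply: excess_ge0; lra.
by move: h1 h2; rewrite mul0r; lra.
Qed.

Lemma res_cE : c = H nu.
Proof.
by rewrite /res_c (res_HE F_mean)// nu_ge0 (le_trans nu_le_nup)// nup_le1.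
Qed.

Lemma res_cE_nup : c = H nup.
Proof. by rewrite res_cE; apply: excess_int_cst => //; exact: nu_le_nup. Qed.

Lemma res_c_le0 : c <= 0.
Proof.
rewrite res_cE -(excess_int0 F); have := nu_ge0; rewrite le_eqVlt => /predU1P[<-//|nu0].
exact/ltW/excess_int_decr.
Qed.

Lemma excess_int_gtcl t : 0 <= t -> t < nu -> c < H t.
Proof. by move=> t0 tnu; rewrite res_cE excess_int_decr. Qed.

Lemma excess_int_gtcr t : nup < t -> t <= 1 -> c < H t.
Proof. by move=> tnu t1; rewrite res_cE_nup excess_int_incr. Qed.

Lemma excess_int_lt0l t : 0 < t -> t <= nu -> H t < 0.
Proof. by move=> t0 tnu; rewrite -(excess_int0 F) excess_int_decr. Qed.

Lemma excess_int_lt0r t : nup <= t -> t < 1 -> H t < 0.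
Proof. by move=> t0 tnu; rewrite -(excess_int1 F_mean) excess_int_incr. Qed.

Lemma excess_int_c t : nu <= t -> t <= nup -> H t = c.
Proof. by move=> t0 tnu; rewrite res_cE; apply/esym/excess_int_cst. Qed.

Lemma excess_int_le0 t : 0 <= t -> t <= 1 -> H t <= 0.
Proof.
rewrite le_eqVlt => /predU1P[<-|t0]; first by rewrite excess_int0.
rewrite le_eqVlt => /predU1P[->|t1]; first by rewrite excess_int1.
have [tnu|nut] := leP t nu; first exact/ltW/excess_int_lt0l.
have [tnup|nupt] := leP t nup; last exact/ltW/excess_int_lt0r/t1/ltW.
by rewrite excess_int_c ?res_c_le0// ltW.
Qed.

(** [res_A] is a choice made by [xget]. Its default is ruled out by the intermediate value theorem
    on [0, nu], where the excess integral falls from 0 to [c]; the point found is not [nu] because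
    [c < y]. *)
Lemma res_AP y : c < y -> y <= 0 -> [/\ 0 <= A y, A y < nu & H (A y) = y].
Proof.
move=> cy y0; have nu1 : nu <= 1 := le_trans nu_le_nup nup_le1.
rewrite /res_A (gt_eqF cy); case: xgetP => [t -> [/andP[t0 tnu]]|].
  by rewrite (res_HE F_mean) ?t0 ?(le_trans (ltW tnu)).
have H01 : {within `[0, nu], continuous H}.
  apply: continuous_subspaceW (excess_int_continuous F_mean).
  by apply: subset_itv; rewrite bnd_simp.
have [|t] := IVT nu_ge0 H01 (v := y).
  rewrite excess_int0 -res_cE; rewrite (min_idPr res_c_le0) (max_idPl res_c_le0).
  by rewrite ltW.
rewrite in_itv/= => /andP[t0 tnu] Ht; move=> /(_ t); case; split.
  rewrite t0/= lt_neqAle tnu andbT; apply: contraTN cy => /eqP tE.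
  by rewrite -Ht tE -res_cE ltxx.
by rewrite (res_HE F_mean) ?t0 ?(le_trans tnu).
Qed.

Lemma res_BP y : c < y -> y <= 0 -> [/\ nup < B y, B y <= 1 & H (B y) = y].
Proof.
move=> cy y0; have nup0 : 0 <= nup := le_trans nu_ge0 nu_le_nup.
rewrite /res_B (gt_eqF cy); case: xgetP => [t -> [/andP[t0 tnu]]|].
  by rewrite (res_HE F_mean) ?tnu ?(le_trans _ (ltW t0)).
have H01 : {within `[nup, 1], continuous H}.
  apply: continuous_subspaceW (excess_int_continuous F_mean).
  by apply: subset_itv; rewrite bnd_simp.
have [|t] := IVT nup_le1 H01 (v := y).
  rewrite (excess_int1 F_mean) -res_cE_nup.
  by rewrite (min_idPl res_c_le0) (max_idPr res_c_le0) ltW.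
rewrite in_itv/= => /andP[t0 tnu] Ht; move=> /(_ t); case; split.
  rewrite tnu andbT lt_neqAle t0 andbT; apply: contraTN cy => /eqP tE.
  by rewrite -Ht -tE -res_cE_nup ltxx.
by rewrite (res_HE F_mean) ?tnu ?(le_trans _ t0).
Qed.

Lemma excess_int_inj_l s t : 0 <= s -> s < nu -> 0 <= t -> t < nu -> H s = H t -> s = t.
Proof.
move=> s0 s1 t0 t1 Hst; case: (ltgtP s t) => // st.
  by have := excess_int_decr s0 st (ltW t1); rewrite Hst ltxx.
by have := excess_int_decr t0 st (ltW s1); rewrite Hst ltxx.
Qed.

Lemma excess_int_inj_r s t : nup < s -> s <= 1 -> nup < t -> t <= 1 -> H s = H t -> s = t.
Proof.
move=> s0 s1 t0 t1 Hst; case: (ltgtP s t) => // st.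
  by have := excess_int_incr (ltW s0) st t1; rewrite Hst ltxx.
by have := excess_int_incr (ltW t0) st s1; rewrite Hst ltxx.
Qed.

Lemma res_A_H t : 0 <= t -> t < nu -> A (H t) = t.
Proof.
move=> t0 tnu.
have t1 : t <= 1 by rewrite (le_trans (ltW tnu))// (le_trans nu_le_nup)// nup_le1.
have [A0 Anu HA] := res_AP (excess_int_gtcl t0 tnu) (excess_int_le0 t0 t1).
exact: excess_int_inj_l.
Qed.

Lemma res_B_H t : nup < t -> t <= 1 -> B (H t) = t.
Proof.
move=> nupt t1; have t0 : 0 <= t by rewrite (le_trans (df_ge0 F mu))// ltW.
have [B0 Bnu HB] := res_BP (excess_int_gtcr nupt t1) (excess_int_le0 t0 t1).
exact: excess_int_inj_r.
Qed.

Lemma res_A_gt0 y : c < y -> y < 0 -> 0 < A y.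
Proof.
move=> cy y0; have [A0 _ HA] := res_AP cy (ltW y0).
rewrite lt_neqAle A0 andbT; apply: contraTN y0 => /eqP A0'.
by rewrite -HA -A0' excess_int0 ltxx.
Qed.

Lemma res_B_lt1 y : c < y -> y < 0 -> B y < 1.
Proof.
move=> cy y0; have [_ B1 HB] := res_BP cy (ltW y0).
rewrite lt_neqAle B1 andbT; apply: contraTN y0 => /eqP B1'.
by rewrite -HB B1' (excess_int1 F_mean) ltxx.
Qed.

Lemma excess_int_le_l y v : c < y -> y <= 0 -> 0 <= v -> v < nu ->
  (H v <= y) = (A y <= v).
Proof.
move=> cy y0 v0 vnu; have [A0 Anu HA] := res_AP cy y0.
apply/idP/idP => [|Av].
  apply: contraLR; rewrite -!ltNge => vA.
  by rewrite -[X in X < _]HA; apply: excess_int_decr => //; exact: ltW.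
rewrite -HA; move: Av; rewrite le_eqVlt => /predU1P[->//|Av].
exact/ltW/excess_int_decr/ltW.
Qed.

Lemma excess_int_le_r y v : c < y -> y <= 0 -> nup < v -> v <= 1 ->
  (H v <= y) = (v <= B y).
Proof.
move=> cy y0 v0 vnu; have [B0 Bnu HB] := res_BP cy y0.
apply/idP/idP => [|Av].
  apply: contraLR; rewrite -!ltNge => Bv.
  by rewrite -[X in X < _]HB; apply: excess_int_incr => //; exact: ltW.
rewrite -HB; move: Av; rewrite le_eqVlt => /predU1P[->//|Av].
by apply/ltW/excess_int_incr => //; exact/ltW.
Qed.

(** The excess integral is below [y] on the whole plateau [nu, nup], from [A y] on in the left
    branch, and up to [B y] in the right one. This is why [res_K] is the length [B - A]. *)
Lemma excess_int_leE y v : c < y -> y <= 0 -> 0 <= v -> v <= 1 ->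
  (H v <= y) = (A y <= v <= B y).
Proof.
move=> cy y0 v0 v1; have [A0 Anu HA] := res_AP cy y0; have [B0 B1 HB] := res_BP cy y0.
have nunup := nu_le_nup.
have [vnu|nuv] := ltP v nu.
  rewrite excess_int_le_l//; case: (leP (A y) v) => //= _; apply/esym; lra.
have [vnup|nupv] := leP v nup.
  by rewrite excess_int_c// (ltW cy); apply/esym; lra.
by rewrite excess_int_le_r//; case: (leP v (B y)) => _ /=; rewrite ?andbF ?andbT//; apply/esym; lra.
Qed.

Lemma excess_int_lecE v : 0 <= v -> v <= 1 -> (H v <= c) = (nu <= v <= nup).
Proof.
move=> v0 v1; have [vnu|nuv] := ltP v nu.
  by apply/negbTE; rewrite -ltNge excess_int_gtcl.
have [vnup|nupv] := leP v nup; first by rewrite excess_int_c// lexx.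
by apply/negbTE; rewrite -ltNge excess_int_gtcr.
Qed.

Lemma excess_int_gec v : 0 <= v -> v <= 1 -> c <= H v.
Proof.
move=> v0 v1; rewrite leNgt; apply/negP => Hc; move: (ltW Hc).
by rewrite excess_int_lecE// => /andP[nuv vnup]; rewrite excess_int_c// ltxx in Hc.
Qed.

End residual.

(** * The residual distribution *)

Section law_of_df.
Context d (T : measurableType d) (R : realType) (P : probability T R).

(** The law of [X] itself is the witness that [G] is a distribution function, so [law_of_df G] is
    not the default value. Thus [res_K] and [residual_df] need no separate check. *)
Lemma law_of_df_preimage (X : T -> R) (G : R -> R) (E : set R) :
  measurable_fun setT X ->
  (forall x, P (X @^-1` `]-oo, x]) = (G x)%:E) ->
  measurable E -> P (X @^-1` E) = law_of_df G E.
Proof.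
move=> mX XG mE; have mX' : measurable_fun setT (X : T -> measurableTypeR R) by [].
pose X' : {mfun T >-> measurableTypeR R} :=
  HB.pack (X : T -> measurableTypeR R) (isMeasurableFun.Build _ _ _ _ _ mX').
apply: (law_preimage (P := P) (m := law_of_df G)) => //.
- by transitivity (1%:E : \bar R); [|apply/esym]; exact: probability_setT.
- by apply: (le_lt_trans (probability_le1 P measurableT)); rewrite ltry.
- move=> x; transitivity (G x)%:E; [exact: XG | rewrite /law_of_df]; case: pselect => [h|[]].
    by apply/esym; exact: (projT2 (cid h)).
  by exists (distribution P X') => y; exact: XG.
Qed.

End law_of_df.

Section residual.
Variables (R : realType) (F : cumulativeBounded (0 : R) 1).
Hypothesis F_mean : has_finite_mean F.
Implicit Types s t u v x y : R.
Local Notation leb := (@lebesgue_measure R).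
Local Notation unif := (uniform_prob (@ltr01 R)).
Local Notation mu := (mean F).
Local Notation q := (rquantile F).
Local Notation H := (excess_int F).
Local Notation excess := (excess F).
Local Notation nu := (res_nu F).
Local Notation nup := (res_nup F).
Local Notation c := (res_c F).
Local Notation A := (res_A F).
Local Notation B := (res_B F).

(** Made total by the value 0, so that it is measurable on the whole line; only ]0, 1[ matters under
    the uniform law. *)
Definition excess_int01 v := if 0 < v < 1 then H v else 0.
Local Notation H01 := excess_int01.

Lemma measurable_excess_int01 : measurable_fun setT H01.
Proof.
apply: measurable_if_itv => //.
apply: (@measurable_funS _ _ _ _ (`[0, 1] : set R)) => //.
  by apply: subset_itv; rewrite bnd_simp.
by apply: subspace_continuous_measurable_fun => //; exact: excess_int_continuous.
Qed.

(** Inside ]0, 1[ the sublevel sets are everything, an interval from [A y] to [B y], the plateau, or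
    empty, matching the cases of [res_K]. Whether endpoints belong to them does not affect their
    length. *)
Lemma res_K_law y : unif (H01 @^-1` `]-oo, y]) = (res_K F y)%:E.
Proof.
have mE : measurable (H01 @^-1` `]-oo, y]).
  by rewrite -[X in measurable X]setTI; apply: measurable_excess_int01 => //;
    exact: measurable_itv.
have H01E v : 0 < v < 1 -> (H01 @^-1` `]-oo, y]) v <-> H v <= y.
  by move=> v01; rewrite /= in_itv/= /excess_int01 v01.
have [[nu0 nup1] nunup] := (nu_ge0 F, nup_le1 F, nu_le_nup F).
rewrite uniform01E// /res_K.
have mE01 : measurable (`]0%R, 1%R[%classic `&` H01 @^-1` `]-oo, y]).
  exact: measurableI.
case: ltP => [y0|y0].
  rewrite (@lebesgue_sub_itv _ _ 0 1) ?subr0//.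
    move=> v; rewrite /= in_itv/= => /andP[v0 v1].
    split; first by rewrite /= ?in_itv/= v0.
    apply/H01E; first by rewrite v0.
    by rewrite (le_trans (excess_int_le0 F_mean (ltW v0) (ltW v1)))// ltW.
  by move=> v [+ _]; apply: subset_itv; rewrite bnd_simp.
case: ltP => [cy|yc].
  have [A0 Anu HA] := res_AP F_mean cy y0; have [B0 B1 HB] := res_BP F_mean cy y0.
  have AB : A y <= B y by rewrite (le_trans (ltW Anu))// (le_trans nunup)// ltW.
  apply: lebesgue_sub_itv => //.
    move=> v; rewrite /= in_itv/= => /andP[Av vB].
    have v0 : 0 < v by exact: le_lt_trans Av.
    have v1 : v < 1 by exact: lt_le_trans B1.
    split; first by rewrite /= ?in_itv/= v0.
    apply/H01E; first by rewrite v0.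
    by rewrite (excess_int_leE F_mean cy y0 (ltW v0) (ltW v1)) !ltW.
  move=> v [/=]; rewrite in_itv/= => v01 /H01E-/(_ v01).
  by case/andP: v01 => /ltW v0 /ltW v1; rewrite (excess_int_leE F_mean cy y0 v0 v1) in_itv.
case: eqP => [yE|/eqP ync].
  apply: lebesgue_sub_itv => //; rewrite {}yE in H01E *.
    move=> v; rewrite /= in_itv/= => /andP[Av vB].
    have v0 : 0 < v by exact: le_lt_trans Av.
    have v1 : v < 1 by exact: lt_le_trans nup1.
    split; first by rewrite /= ?in_itv/= v0.
    apply/H01E; first by rewrite v0.
    by rewrite (excess_int_lecE F_mean (ltW v0) (ltW v1)) !ltW.
  move=> v [/=]; rewrite in_itv/= => v01 /H01E-/(_ v01).
  by case/andP: v01 => /ltW v0 /ltW v1; rewrite (excess_int_lecE F_mean v0 v1) in_itv.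
rewrite (_ : _ `&` _ = set0) ?measure0//; apply/seteqP; split => // v [/=].
rewrite in_itv/= => v01 /H01E-/(_ v01); case/andP: v01 => /ltW v0 /ltW v1.
have := excess_int_gec F_mean v0 v1 => cH Hy.
by move: ync; rewrite eq_le yc (le_trans cH Hy).
Qed.

End residual.

(** * Conditional endpoints, the mixing probability, and the transfer between the branches *)

Section residual.
Variables (R : realType) (F : cumulativeBounded (0 : R) 1).
Hypothesis F_mean : has_finite_mean F.
Implicit Types s t u v x y : R.
Local Notation leb := (@lebesgue_measure R).
Local Notation mu := (mean F).
Local Notation q := (rquantile F).
Local Notation H := (excess_int F).
Local Notation H01 := (excess_int01 F).
Local Notation excess := (excess F).
Local Notation nu := (res_nu F).
Local Notation nup := (res_nup F).
Local Notation c := (res_c F).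
Local Notation A := (res_A F).
Local Notation B := (res_B F).

(** The deviation alpha - mu; [dev_hi] is beta - mu. Both are 0 off ]c, 0[: at [c] the conditional
    law is a point mass at the mean, and at 0 the quantiles may be infinite. *)
Definition dev_lo y := if c < y < 0 then excess (A y) else 0.
Definition dev_hi y := if c < y < 0 then excess (B y) else 0.
Definition dev_gap y := dev_hi y - dev_lo y.
(** The probability p of the upper endpoint. Off ]c, 0[ it is 0, through the convention that
    dividing by 0 gives 0. *)
Definition hi_prob y := - dev_lo y / dev_gap y.

Lemma dev_lo_lt0 y : c < y < 0 -> dev_lo y < 0.
Proof.
move=> /[dup] cy0 /andP[cy y0]; rewrite /dev_lo cy0.
have [_ Anu _] := res_AP F_mean cy (ltW y0).
by apply: excess_lt0 => //; exact: res_A_gt0.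
Qed.

Lemma dev_hi_gt0 y : c < y < 0 -> 0 < dev_hi y.
Proof.
move=> /[dup] cy0 /andP[cy y0]; rewrite /dev_hi cy0.
have [nupB _ _] := res_BP F_mean cy (ltW y0).
by apply: excess_gt0 => //; exact: res_B_lt1.
Qed.

Lemma dev_lo_le0 y : dev_lo y <= 0.
Proof.
have [/dev_lo_lt0/ltW//|/negbTE cy0] := boolP (c < y < 0).
by rewrite /dev_lo cy0.
Qed.

Lemma dev_hi_ge0 y : 0 <= dev_hi y.
Proof.
have [/dev_hi_gt0/ltW//|/negbTE cy0] := boolP (c < y < 0).
by rewrite /dev_hi cy0.
Qed.

Lemma dev_gap_ge0 y : 0 <= dev_gap y.
Proof. by rewrite subr_ge0 (le_trans (dev_lo_le0 y))// dev_hi_ge0. Qed.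

Lemma dev_gap_gt0 y : c < y < 0 -> 0 < dev_gap y.
Proof.
by move=> cy0; rewrite subr_gt0 (lt_trans (dev_lo_lt0 cy0))// dev_hi_gt0.
Qed.

(** Equivalent to [lo + p * gap = 0]: the two-point law has mean [mu]. Off ]c, 0[ both sides
    vanish. *)
Lemma hi_prob_gap y : hi_prob y * dev_gap y = - dev_lo y.
Proof.
have [cy0|/negbTE cy0] := boolP (c < y < 0).
  by rewrite /hi_prob divfK// gt_eqF// dev_gap_gt0.
by rewrite /hi_prob /dev_gap /dev_hi /dev_lo cy0 oppr0 addr0 mulr0.
Qed.

Lemma hi_prob_ge0 y : 0 <= hi_prob y.
Proof. by rewrite divr_ge0 ?dev_gap_ge0// oppr_ge0 dev_lo_le0. Qed.

Lemma hi_prob_le1 y : hi_prob y <= 1.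
Proof.
have := dev_gap_ge0 y; rewrite le_eqVlt => /predU1P[g0|g0].
  by rewrite /hi_prob -g0 invr0 mulr0.
by rewrite ler_pdivrMr// mul1r /dev_gap lerDr dev_hi_ge0.
Qed.

Lemma dev_hi_lo y : dev_hi y = dev_lo y + dev_gap y.
Proof. by rewrite /dev_gap addrC subrK. Qed.

Lemma measurable_excess : measurable_fun (`]0, 1[ : set R) excess.
Proof. by apply: measurable_funB => //; exact: measurable_rquantile. Qed.

(** As [y] grows to 0, [A y] moves left and [B y] moves right. Monotonicity is the source of
    measurability for endpoints that are defined only by choice. *)
Lemma dev_lo_ni : {in `]c, 0[ &, {homo dev_lo : x y / x <= y >-> y <= x}}.
Proof.
move=> x y; rewrite !in_itv/= => cx0 cy0 xy; rewrite /dev_lo cx0 cy0.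
case/andP: cx0 cy0 => cx x0 /andP[cy y0].
have [Ax0 Axnu HAx] := res_AP F_mean cx (ltW x0).
have [Ay0 Aynu HAy] := res_AP F_mean cy (ltW y0).
have nu1 : nu <= 1 := le_trans (nu_le_nup F) (nup_le1 F).
apply: excess_nd; rewrite ?in_itv/= ?res_A_gt0// ?(lt_le_trans _ nu1)//.
rewrite leNgt; apply: contraTN xy => AxAy.
by rewrite -ltNge -HAx -HAy excess_int_decr// ltW.
Qed.

Lemma dev_hi_nd : {in `]c, 0[ &, {homo dev_hi : x y / x <= y}}.
Proof.
move=> x y; rewrite !in_itv/= => cx0 cy0 xy; rewrite /dev_hi cx0 cy0.
case/andP: cx0 cy0 => cx x0 /andP[cy y0].
have [Bx0 Bx1 HBx] := res_BP F_mean cx (ltW x0).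
have [By0 By1 HBy] := res_BP F_mean cy (ltW y0).
have nup0 : 0 <= nup := df_ge0 F mu.
apply: excess_nd; rewrite ?in_itv/= ?res_B_lt1 ?(le_lt_trans nup0)//.
rewrite leNgt; apply: contraTN xy => BxBy.
by rewrite -ltNge -HBx -HBy excess_int_incr// ltW.
Qed.

Lemma measurable_dev_lo : measurable_fun setT dev_lo.
Proof.
rewrite (_ : dev_lo = (fun y => if c < y < 0 then dev_lo y else 0)).
  by apply: measurable_if_itv => //; apply: nonincreasing_in_measurable; exact: dev_lo_ni.
by apply/funext => y; rewrite /dev_lo; case: ifP.
Qed.

Lemma measurable_dev_hi : measurable_fun setT dev_hi.
Proof.
rewrite (_ : dev_hi = (fun y => if c < y < 0 then dev_hi y else 0)).
  by apply: measurable_if_itv => //; apply: nondecreasing_in_measurable; exact: dev_hi_nd.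
by apply/funext => y; rewrite /dev_hi; case: ifP.
Qed.

Lemma measurable_dev_gap : measurable_fun setT dev_gap.
Proof. exact: measurable_funB measurable_dev_hi measurable_dev_lo. Qed.

Lemma dev_gap_nd : {in `]c, 0[ &, {homo dev_gap : x y / x <= y}}.
Proof.
by move=> x y cx cy xy; rewrite lerB ?dev_lo_ni ?dev_hi_nd.
Qed.

(* The gap vanishes outside ]c, 0[, where 0^-1 = 0; on ]c, 0[ it is positive
   and nondecreasing. *)
Lemma measurable_dev_gapV : measurable_fun setT (fun y => (dev_gap y)^-1).
Proof.
rewrite (_ : (fun _ => _) = (fun y => if c < y < 0 then (dev_gap y)^-1 else 0)).
  apply: measurable_if_itv => //; apply: nonincreasing_in_measurable => x y cx cy xy.
  by rewrite lef_pV2 ?posrE ?dev_gap_gt0 ?dev_gap_nd//; move: cx cy; rewrite !in_itv.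
apply/funext => y; case: ifPn => // /negbTE cy0.
by rewrite /dev_gap /dev_hi /dev_lo cy0 subrr invr0.
Qed.

Lemma measurable_hi_prob : measurable_fun setT hi_prob.
Proof.
apply: measurable_funM; last exact: measurable_dev_gapV.
by apply: measurableT_comp => //; exact: measurable_dev_lo.
Qed.

Definition excess_neg t := if 0 < t < nu then - excess t else 0.
Definition excess_pos t := if nup < t < 1 then excess t else 0.

Lemma excess_neg_ge0 t : 0 <= excess_neg t.
Proof.
rewrite /excess_neg; case: ifPn => // /andP[t0 tnu].
by rewrite oppr_ge0 ltW// excess_lt0.
Qed.

Lemma excess_pos_ge0 t : 0 <= excess_pos t.
Proof.
rewrite /excess_pos; case: ifPn => // /andP[t0 tnu].
by rewrite ltW// excess_gt0.
Qed.

Lemma measurable_excess_neg : measurable_fun setT excess_neg.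
Proof.
apply: measurable_if_itv => //; apply: measurable_funN.
apply: measurable_funS measurable_excess => //; apply: subset_itvl.
by rewrite bnd_simp (le_trans (nu_le_nup F) (nup_le1 F)).
Qed.

Lemma measurable_excess_pos : measurable_fun setT excess_pos.
Proof.
apply: measurable_if_itv => //.
apply: measurable_funS measurable_excess => //; apply: subset_itvr.
by rewrite bnd_simp df_ge0.
Qed.

Lemma integral_excess a b : 0 <= a -> a <= b -> b <= 1 ->
  (\int[leb]_(t in `]a, b[) (excess t)%:E = (H b - H a)%:E)%E.
Proof.
move=> a0 ab b1; rewrite (excess_int_sub F_mean)// /Rintegral fineK//.
exact/integrable_fin_num/integrable_excessS.
Qed.

(** Up to the null set containing only [a], the relevant part of [S] is ]a, nu[, over which the
    excess integrates to [c - H a]. Leaving the point [a] free lets sublevel sets be used without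
    deciding their boundary. *)
Lemma integral_excess_neg a S : measurable S -> 0 <= a -> a <= nu ->
  (forall t, 0 < t < nu -> t != a -> S t <-> a < t) ->
  (\int[leb]_(t in S) (excess_neg t)%:E = (H a - c)%:E)%E.
Proof.
move=> mS a0 anu SE; have nu1 : nu <= 1 := le_trans (nu_le_nup F) (nup_le1 F).
rewrite integral_if_itv.
have ES : (S `&` `]0, nu[%classic) `\ a = `]a, nu[%classic.
  apply/seteqP; split => t /=; rewrite !in_itv/=.
    by move=> [[St tnu] /eqP ta]; rewrite (SE t tnu ta).1//; case/andP: tnu.
  move=> /andP[at_ tnu]; have t0nu : 0 < t < nu by rewrite (le_lt_trans a0).
  have ta : t != a by rewrite gt_eqF.
  by split; [split=> //; apply/SE|apply/eqP].
rewrite -(@integral_setD1 _ _ a) ES//; last first.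
  apply/measurable_EFinP/measurable_funN.
  by apply: measurable_funS measurable_excess => //; apply: subset_itv; rewrite bnd_simp.
under eq_integral do rewrite EFinN.
rewrite integralN/=; last first.
  apply: fin_num_adde_defr; apply: integrable_pos_fin_num => //.
  exact: integrable_excessS.
by rewrite integral_excess// -EFinN opprB -res_cE.
Qed.

Lemma integral_excess_pos b S : measurable S -> nup <= b -> b <= 1 ->
  (forall t, nup < t < 1 -> t != b -> S t <-> t < b) ->
  (\int[leb]_(t in S) (excess_pos t)%:E = (H b - c)%:E)%E.
Proof.
move=> mS b0 b1 SE; have nup0 : 0 <= nup := df_ge0 F mu.
rewrite integral_if_itv.
have ES : (S `&` `]nup, 1[%classic) `\ b = `]nup, b[%classic.
  apply/seteqP; split => t /=; rewrite !in_itv/=.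
    by move=> [[St tnu] /eqP ta]; rewrite (SE t tnu ta).1//; case/andP: tnu => ->.
  move=> /andP[at_ tnu]; have t0nu : nup < t < 1 by rewrite at_ (lt_le_trans tnu).
  have ta : t != b by rewrite lt_eqF.
  by split; [split=> //; apply/SE|apply/eqP].
rewrite -(@integral_setD1 _ _ b) ES//; last first.
  apply/measurable_EFinP.
  by apply: measurable_funS measurable_excess => //; apply: subset_itv; rewrite bnd_simp.
by rewrite integral_excess// -res_cE_nup.
Qed.

(** Both densities give the ray up to [s] the same mass under the excess integral: [- c] for
    [s >= 0], [s - c] for [c < s < 0], and 0 for [s <= c]. In the middle case the two sets are cut
    off at [A s] and [B s], which have the same image [s]. *)
Lemma integral_excess_transfer (g : R -> R) : measurable_fun setT g -> (forall y, 0 <= g y) ->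
  (\int[leb]_t (g (H01 t) * excess_neg t)%:E =
   \int[leb]_t (g (H01 t) * excess_pos t)%:E)%E.
Proof.
have [[nu0 nup1] nunup] := (nu_ge0 F, nup_le1 F, nu_le_nup F).
have nup0 : 0 <= nup := df_ge0 F mu.
have nu1 : nu <= 1 := le_trans nunup nup1.
have negT : (\int[leb]_t (excess_neg t)%:E = (- c)%:E)%E.
  rewrite (@integral_excess_neg 0)// ?excess_int0 ?sub0r//.
  by move=> t /andP[-> _] _.
have posT : (\int[leb]_t (excess_pos t)%:E = (- c)%:E)%E.
  rewrite (@integral_excess_pos 1)// ?excess_int1 ?sub0r//.
  by move=> t /andP[_ ->] _.
apply: integral_density_rays.
- exact: measurable_excess_int01.
- exact: measurable_excess_neg.
- exact: measurable_excess_pos.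
- exact: excess_neg_ge0.
- exact: excess_pos_ge0.
- by rewrite negT ltry.
- by rewrite negT posT.
move=> s.
have mS : measurable (H01 @^-1` `]-oo, s]).
  by rewrite -[X in measurable X]setTI; apply: measurable_excess_int01 => //;
    exact: measurable_itv.
have SE t : 0 < t < 1 -> (H01 @^-1` `]-oo, s]) t <-> H t <= s.
  by move=> v01; rewrite /= in_itv/= /excess_int01 v01.
have l01 t : 0 < t < nu -> 0 < t < 1 by move=> /andP[-> /lt_le_trans ->].
have r01 t : nup < t < 1 -> 0 < t < 1 by move=> /andP[/(le_lt_trans nup0) -> ->].
have [s0|s0] := leP 0 s.
  rewrite (@integral_excess_neg 0)// ?excess_int0//; last first.
    move=> t /[dup] /l01 t01 /andP[t0 tnu] _; split=> // _; apply/(SE _ t01).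
    by rewrite (le_trans _ s0)// excess_int_le0// ltW//; case/andP: t01.
  rewrite (@integral_excess_pos 1)// ?excess_int1//.
  move=> t /[dup] /r01 t01 /andP[t0 tnu] _; split=> // _; apply/(SE _ t01).
  by rewrite (le_trans _ s0)// excess_int_le0// ltW//; case/andP: t01.
have [cs|sc] := ltP c s.
  have [A0 Anu HA] := res_AP F_mean cs (ltW s0).
  have [B0 B1 HB] := res_BP F_mean cs (ltW s0).
  rewrite (@integral_excess_neg (A s))// ?(ltW Anu)//; last first.
    move=> t /[dup] /l01 t01 /andP[t0 tnu] tA; rewrite SE//.
    by rewrite excess_int_le_l ?(ltW t0) ?(ltW s0)// le_eqVlt eq_sym (negbTE tA).
  rewrite (@integral_excess_pos (B s))// ?(ltW B0) ?HA ?HB//.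
  move=> t /[dup] /r01 t01 /andP[t0 tnu] tB; rewrite SE//.
  by rewrite excess_int_le_r ?(ltW tnu) ?(ltW s0)// le_eqVlt (negbTE tB).
rewrite (@integral_excess_neg nu)//; last first.
  move=> t /[dup] /l01 t01 /andP[t0 tnu] _; rewrite SE//; split.
    by move=> /le_trans/(_ sc); rewrite leNgt excess_int_gtcl// ltW.
  by move=> /lt_trans/(_ tnu); rewrite ltxx.
rewrite (@integral_excess_pos nup)// -?res_cE -?res_cE_nup//.
move=> t /[dup] /r01 t01 /andP[t0 tnu] _; rewrite SE//; split.
  by move=> /le_trans/(_ sc); rewrite leNgt excess_int_gtcr// ltW.
by move=> /lt_trans/(_ t0); rewrite ltxx.
Qed.

End residual.

(** * The law of the gap, and the two-point mixture that reproduces the original distribution *)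

Section residual.
Variables (R : realType) (F : cumulativeBounded (0 : R) 1).
Hypothesis F_mean : has_finite_mean F.
Implicit Types s t u v x y : R.
Local Notation leb := (@lebesgue_measure R).
Local Notation unif := (uniform_prob (@ltr01 R)).
Local Notation mu := (mean F).
Local Notation q := (rquantile F).
Local Notation H := (excess_int F).
Local Notation H01 := (excess_int01 F).
Local Notation excess := (excess F).
Local Notation nu := (res_nu F).
Local Notation nup := (res_nup F).
Local Notation c := (res_c F).
Local Notation A := (res_A F).
Local Notation B := (res_B F).
Local Notation lo := (dev_lo F).
Local Notation hi := (dev_hi F).
Local Notation gap := (dev_gap F).
Local Notation p := (hi_prob F).
Local Notation eneg := (excess_neg F).
Local Notation epos := (excess_pos F).

Lemma excess_int_in_l v : 0 < v < nu -> c < H v < 0.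
Proof.
by move=> /andP[v0 vnu]; rewrite excess_int_gtcl ?(ltW v0)//= excess_int_lt0l// ltW.
Qed.

Lemma excess_int_in_r v : nup < v < 1 -> c < H v < 0.
Proof.
by move=> /andP[v0 v1]; rewrite excess_int_gtcr ?(ltW v1)//= excess_int_lt0r// ltW.
Qed.

Lemma dev_lo_excess_int v : 0 < v < nu -> lo (H v) = excess v.
Proof.
move=> /[dup] v0nu /andP[v0 vnu]; rewrite /dev_lo excess_int_in_l//.
by rewrite res_A_H// ltW.
Qed.

Lemma dev_hi_excess_int v : nup < v < 1 -> hi (H v) = excess v.
Proof.
move=> /[dup] v0nu /andP[v0 v1]; rewrite /dev_hi excess_int_in_r//.
by rewrite res_B_H// ltW.
Qed.

Lemma excess_mid v : nu < v -> v < nup -> excess v = 0.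
Proof.
move=> nuv vnup; have v0 : 0 < v by rewrite (le_lt_trans (nu_ge0 F)).
have v1 : v < 1 by rewrite (lt_le_trans vnup)// nup_le1.
by apply/le_anti; rewrite excess_le0 ?excess_ge0// ltW.
Qed.

Lemma residual_gap_in y : c < y < 0 -> residual_gap F y = (gap y)%:E.
Proof.
have nup0 : 0 <= nup := df_ge0 F mu.
have nu1 : nu <= 1 := le_trans (nu_le_nup F) (nup_le1 F).
move=> /[dup] cy0 /andP[cy y0].
have [A0 Anu HA] := res_AP F_mean cy (ltW y0).
have [B0 B1 HB] := res_BP F_mean cy (ltW y0).
rewrite /residual_gap !quantileE ?res_A_gt0 ?res_B_lt1//=.
- by rewrite -EFinB /dev_gap /dev_hi /dev_lo cy0 opprB addrA subrK.
- exact: lt_le_trans nu1.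
- by rewrite andbT (le_lt_trans nup0).
Qed.

Lemma residual_gapE v : 0 < v < 1 -> v != nu -> v != nup ->
  residual_gap F (H v) = (gap (H v))%:E.
Proof.
have [[nu0 nup1] nunup] := (nu_ge0 F, nup_le1 F, nu_le_nup F).
have nup0 : 0 <= nup := df_ge0 F mu.
have nu1 : nu <= 1 := le_trans nunup nup1.
move=> /andP[v0 v1] vnu vnup.
have [vltnu|nuv] := ltP v nu; first by rewrite residual_gap_in// excess_int_in_l ?v0.
have [nupv|vlenup] := ltP nup v; first by rewrite residual_gap_in// excess_int_in_r ?nupv.
have nupgt0 : 0 < nup by rewrite (lt_le_trans v0).
(* On the plateau both endpoints are [nup], so the gap is 0 once [quantile nup] is finite. As [nup]
   may be 1, finiteness comes from [F mu = nup]. *)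
rewrite excess_int_c// /residual_gap /res_A /res_B eqxx subee; last first.
  by apply: quantile_fin_num => //; exact: lexx.
by rewrite /dev_gap /dev_hi /dev_lo ltxx subrr.
Qed.

(** Outside the range of the excess integral both choices fall back on the default 0 of [xget], so
    [residual_gap] is constant there. This serves its measurability. *)
Lemma res_AB_out y : ~~ (c <= y <= 0) -> res_A F y = 0 /\ res_B F y = 0.
Proof.
have [[nu0 nup1] nunup] := (nu_ge0 F, nup_le1 F, nu_le_nup F).
have nup0 : 0 <= nup := df_ge0 F mu.
have nu1 : nu <= 1 := le_trans nunup nup1.
move=> cy0.
have yc : (y == c) = false.
  by apply/negbTE; apply: contra cy0 => /eqP ->; rewrite lexx res_c_le0.
have out t : 0 <= t -> t <= 1 -> res_H F t <> y.
  move=> t0 t1 ty; move: cy0; rewrite -ty (res_HE F_mean) ?t0//.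
  by rewrite excess_int_gec// excess_int_le0.
rewrite /res_A /res_B yc; split; case: xgetP => // t -> [/andP[t0 t1]] /out []//.
- by rewrite (le_trans (ltW t1)).
- by rewrite (le_trans nup0)// ltW.
Qed.

Lemma measurable_residual_gap : measurable_fun setT (residual_gap F).
Proof.
pose k := (quantile F 0 - quantile F 0)%E.
rewrite (_ : residual_gap F = (fun y => if c < y < 0 then (gap y)%:E else
   if y == c then residual_gap F c else
   if y == 0 then residual_gap F 0 else k)); last first.
  apply/funext => y; case: ifPn => [/residual_gap_in//|ncy0].
  case: eqP => [->//|/eqP yc]; case: eqP => [->//|/eqP y0].
  rewrite /residual_gap; have [|-> ->//] := @res_AB_out y.
  by apply: contra ncy0; rewrite !lt_neqAle eq_sym yc y0.
have mle : measurable_fun setT (fun y : R => c < y < 0).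
  by apply: measurable_and; apply: measurable_fun_ltr.
have meq k' : measurable_fun setT (fun y : R => y == k') by exact: measurable_fun_eqr.
apply: measurable_fun_ifT => //.
  by apply/measurable_EFinP; exact: measurable_dev_gap.
by apply: measurable_fun_ifT => //; exact: measurable_fun_ifT.
Qed.

(** [res_K] is the law of the excess integral at a uniform point, so the event moves to ]0, 1[.
    There the extended-real gap can be replaced by [dev_gap] almost everywhere. *)
Lemma residual_df_law z :
  unif ((gap \o H01) @^-1` `]-oo, z]) = (residual_df F z)%:E.
Proof.
pose E := [set y | (residual_gap F y <= z%:E)%E].
have mE : measurable E.
  rewrite -[X in measurable X]setTI (_ : E = residual_gap F @^-1` `]-oo, z%:E]).
    by apply: measurable_residual_gap => //; exact: emeasurable_itv.
  by apply/seteqP; split => y; rewrite /E/= in_itv.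
have mH := measurable_excess_int01 F_mean.
have UE := law_of_df_preimage (P := unif) mH (res_K_law F_mean) mE.
rewrite /residual_df fineK; last exact: fin_num_measure.
rewrite -/E -UE.
have mHE : measurable (H01 @^-1` E).
  by rewrite -[X in measurable X]setTI; exact: mH.
have mgz : measurable ((gap \o H01) @^-1` `]-oo, z]).
  rewrite -[X in measurable X]setTI.
  by apply: (measurableT_comp (measurable_dev_gap F_mean) mH) => //;
    exact: measurable_itv.
rewrite (uniform01E mgz); transitivity (leb (`]0%R, 1%R[%classic `&` H01 @^-1` E));
  last exact/esym/uniform01E.
apply: (@lebesgue_eq_except2 _ nu nup);
  [exact: measurableI|exact: measurableI|move=> v vnu vnup].
suff : 0 < v < 1 -> ((gap \o H01) @^-1` `]-oo, z]) v <-> (H01 @^-1` E) v.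
  by move=> h; split => -[] /[dup] v01; rewrite {1}/mkset in_itv/= => /h{}h vE; split=> //;
    apply/h.
move=> v01; rewrite /E/= in_itv/= /excess_int01 v01.
by rewrite residual_gapE// lee_fin.
Qed.

(** On the left branch [lo] recovers the quantile, and the mixture differs from the indicator at
    [q v] by the weight [p = eneg / gap] shifted to the upper endpoint. On the right branch the
    weight [1 - p = epos / gap] is shifted to the lower one. By [integral_excess_transfer] the two
    shifts balance. *)
Lemma integral_mixture (S : set R) : measurable S ->
  (\int[leb]_(v in `]0%R, 1%R[)
     ((1 - p (H01 v)) * \1_S (mu + lo (H01 v)) + p (H01 v) * \1_S (mu + hi (H01 v)))%:E =
   lebesgue_stieltjes_measure F S)%E.
Proof.
move=> mS.
have [[nu0 nup1] nunup] := (nu_ge0 F, nup_le1 F, nu_le_nup F).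
have nup0 : 0 <= nup := df_ge0 F mu.
have nu1 : nu <= 1 := le_trans nunup nup1.
have mH := measurable_excess_int01 F_mean.
have mloS : measurable_fun setT (fun y => \1_S (mu + lo y) : R).
  apply: (measurableT_comp (f := (\1_S : R -> R))) => //.
  by apply: measurable_funD => //; exact: measurable_dev_lo.
have mhiS : measurable_fun setT (fun y => \1_S (mu + hi y) : R).
  apply: (measurableT_comp (f := (\1_S : R -> R))) => //.
  by apply: measurable_funD => //; exact: measurable_dev_hi.
have mp := measurable_hi_prob F_mean.
pose G y := (1 - p y) * \1_S (mu + lo y) + p y * \1_S (mu + hi y).
(* Indicators at the upper and at the lower endpoint, per unit of gap: multiplied by [eneg] or
   [epos] they are the shifted masses. *)
pose T1 y := \1_S (mu + hi y) / gap y.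
pose T2 y := \1_S (mu + lo y) / gap y.
have mT1 : measurable_fun setT T1.
  by apply: measurable_funM => //; exact: measurable_dev_gapV.
have mT2 : measurable_fun setT T2.
  by apply: measurable_funM => //; exact: measurable_dev_gapV.
have mG : measurable_fun setT G.
  apply: measurable_funD; apply: measurable_funM => //.
  exact: measurable_funB.
have T10 y : 0 <= T1 y by rewrite divr_ge0 ?dev_gap_ge0.
have T20 y : 0 <= T2 y by rewrite divr_ge0 ?dev_gap_ge0.
have G0 y : 0 <= G y.
  by rewrite addr_ge0// mulr_ge0 ?hi_prob_ge0// subr_ge0 hi_prob_le1.
have mq1 : measurable_fun (`]0, 1[ : set R) (fun v => \1_S (q v) : R).
  apply: (measurableT_comp (f := (\1_S : R -> R))) => //.
  exact: measurable_rquantile.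
(* The pointwise balance, with every term moved to the side where it is nonnegative. *)
have key v : 0 < v < 1 -> v != nu -> v != nup ->
    G (H01 v) + (T2 (H01 v) * eneg v + T1 (H01 v) * epos v) =
    \1_S (q v) + (T2 (H01 v) * epos v + T1 (H01 v) * eneg v).
  move=> /[dup] v01 /andP[v0 v1] vnu vnup; rewrite /excess_int01 v01.
  rewrite /excess_neg /excess_pos v0 v1 /= andbT.
  have muq : mu + excess v = q v by rewrite addrC subrK.
  have [vltnu|nuv] := ltP v nu.
    have v0nu : 0 < v < nu by rewrite v0.
    have gap0 := dev_gap_gt0 F_mean (excess_int_in_l v0nu).
    rewrite ltNge (le_trans (ltW vltnu))//= /G /T1 /T2 /hi_prob.
    rewrite dev_lo_excess_int// muq; field; exact: lt0r_neq0.
  have [nupv|vlenup] := ltP nup v.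
    have vnup1 : nup < v < 1 by rewrite nupv.
    have gap0 := dev_gap_gt0 F_mean (excess_int_in_r vnup1).
    rewrite /G /T1 /T2 /hi_prob.
    have -> : 1 - - lo (H v) / gap (H v) = hi (H v) / gap (H v).
      rewrite dev_hi_lo; field; exact: lt0r_neq0.
    have -> : - lo (H v) / gap (H v) = 1 - hi (H v) / gap (H v).
      rewrite dev_hi_lo; field; exact: lt0r_neq0.
    by rewrite dev_hi_excess_int// muq; ring.
  have ex0 : excess v = 0 by apply: excess_mid; rewrite lt_neqAle ?vnup// eq_sym vnu.
  rewrite excess_int_c// /G /dev_lo /dev_hi ltxx/= !addr0 !mulr0 !addr0.
  by rewrite -muq ex0 addr0; ring.
have mTe (T e : R -> R) : measurable_fun setT T -> measurable_fun setT e ->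
    measurable_fun setT (fun v => (T (H01 v) * e v)%:E).
  move=> mT me; apply/measurable_EFinP/measurable_funM => //.
  exact: measurableT_comp.
have res (T e : R -> R) : (forall v, ~~ (0 < v < 1) -> e v = 0) ->
    (\int[leb]_(v in `]0%R, 1%R[) (T (H01 v) * e v)%:E =
     \int[leb]_v (T (H01 v) * e v)%:E)%E.
  move=> e0; rewrite integral_mkcond; apply: eq_integral => v _.
  by rewrite patchE mem_setE in_itv/=; case: ifPn => // /e0 ->; rewrite mulr0.
have neg0 v : ~~ (0 < v < 1) -> eneg v = 0.
  rewrite /excess_neg; case: ifPn => // /andP[v0 vnu].
  by rewrite v0 (lt_le_trans vnu).
have pos0 v : ~~ (0 < v < 1) -> epos v = 0.
  rewrite /excess_pos; case: ifPn => // /andP[v0 v1].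
  by rewrite v1 (le_lt_trans nup0).
(* On ]0, nu[ the quotient [eneg / gap] is [hi_prob], hence at most 1. This bounds the integral
   although the inverse gap may be unbounded. *)
have fin (T : R -> R) : measurable_fun setT T -> (forall y, 0 <= T y <= (gap y)^-1) ->
    (\int[leb]_(v in `]0%R, 1%R[) (T (H01 v) * eneg v)%:E)%E \is a fin_num.
  move=> mT T0; rewrite ge0_fin_numE; last first.
    apply: integral_ge0 => v _; rewrite lee_fin mulr_ge0 ?excess_neg_ge0//.
    by case/andP: (T0 (H01 v)).
  apply: (@le_lt_trans _ _ (\int[leb]_(v in `]0%R, 1%R[) (cst 1%:E v))%E).
    apply: ge0_le_integral => //.
    - move=> v _; rewrite lee_fin mulr_ge0 ?excess_neg_ge0//.
      by case/andP: (T0 (H01 v)).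
    - by apply: measurable_funTS; apply: mTe => //; exact: measurable_excess_neg.
    - move=> v; rewrite /= in_itv/= => v01; rewrite lee_fin.
      apply: (@le_trans _ _ ((gap (H01 v))^-1 * eneg v)).
        by rewrite ler_wpM2r ?excess_neg_ge0//; case/andP: (T0 (H01 v)).
      rewrite /excess_neg /excess_int01 v01; case: ifPn => [v0nu|_]; last by rewrite mulr0.
      by rewrite -(dev_lo_excess_int v0nu) mulrC hi_prob_le1.
  by rewrite integral_cst//= lebesgue_measure_itv/= lte_fin ltr01 sube0 mule1 ltry.
have T1b y : 0 <= T1 y <= (gap y)^-1.
  by rewrite T10/= ler_piMl ?invr_ge0 ?dev_gap_ge0// indicE lern1 leq_b1.
have T2b y : 0 <= T2 y <= (gap y)^-1.
  by rewrite T20/= ler_piMl ?invr_ge0 ?dev_gap_ge0// indicE lern1 leq_b1.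
have mneg := measurable_excess_neg F; have mpos := measurable_excess_pos F.
(* After the transfer, the corrections on both sides of [key] have this same integral. Being finite,
   it can be cancelled. *)
pose K := ((\int[leb]_(v in `]0%R, 1%R[) (T2 (H01 v) * eneg v)%:E) +
  (\int[leb]_(v in `]0%R, 1%R[) (T1 (H01 v) * eneg v)%:E))%E.
have Kfin : K \is a fin_num.
  by rewrite /K fin_numD; apply/andP; split; [exact: fin mT2 T2b|exact: fin mT1 T1b].
have nn (T e : R -> R) v : (forall y, 0 <= T y) -> (forall w, 0 <= e w) ->
    (0 <= (T (H01 v) * e v)%:E)%E by move=> T0 e0; rewrite lee_fin mulr_ge0.
have split2 (g : R -> R) (e1 e2 : R -> R) :
    measurable_fun (`]0, 1[ : set R) g -> (forall v, 0 <= g v) ->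
    measurable_fun setT e1 -> measurable_fun setT e2 ->
    (forall v, 0 <= e1 v) -> (forall v, 0 <= e2 v) ->
    (\int[leb]_(v in `]0%R, 1%R[) (g v + (T2 (H01 v) * e1 v + T1 (H01 v) * e2 v))%:E =
     \int[leb]_(v in `]0%R, 1%R[) (g v)%:E +
     (\int[leb]_(v in `]0%R, 1%R[) (T2 (H01 v) * e1 v)%:E +
      \int[leb]_(v in `]0%R, 1%R[) (T1 (H01 v) * e2 v)%:E))%E.
  move=> mg g0 me1 me2 e10 e20.
  under eq_integral do rewrite !EFinD.
  rewrite ge0_integralD//.
  - congr (_ + _)%E; rewrite ge0_integralD//.
    + by move=> v _; exact: nn.
    + by apply: measurable_funTS; exact: mTe.
    + by move=> v _; exact: nn.
    + by apply: measurable_funTS; exact: mTe.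
  - by move=> v _; rewrite lee_fin.
  - exact/measurable_EFinP.
  - by move=> v _; rewrite adde_ge0// nn.
  - by apply: emeasurable_funD; apply: measurable_funTS; exact: mTe.
have msum (g e1 e2 : R -> R) : measurable_fun (`]0, 1[ : set R) g ->
    measurable_fun setT e1 -> measurable_fun setT e2 ->
    measurable_fun (`]0, 1[ : set R)
      (fun v => (g v + (T2 (H01 v) * e1 v + T1 (H01 v) * e2 v))%:E).
  move=> mg me1 me2; apply/measurable_EFinP/measurable_funD => //.
  apply: measurable_funTS; apply: measurable_funD; apply: measurable_funM => //;
    exact: measurableT_comp.
have mGH : measurable_fun (`]0, 1[ : set R) (G \o H01).
  by apply: measurable_funTS; exact: measurableT_comp.
have main : (\int[leb]_(v in `]0%R, 1%R[) (G (H01 v))%:E + K =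
             \int[leb]_(v in `]0%R, 1%R[) (\1_S (q v))%:E + K)%E.
  have tr (T : R -> R) : measurable_fun setT T -> (forall y, 0 <= T y) ->
      (\int[leb]_(v in `]0%R, 1%R[) (T (H01 v) * eneg v)%:E =
       \int[leb]_(v in `]0%R, 1%R[) (T (H01 v) * epos v)%:E)%E.
    by move=> mT T0; rewrite !res// integral_excess_transfer.
  transitivity (\int[leb]_(v in `]0%R, 1%R[)
      (G (H01 v) + (T2 (H01 v) * eneg v + T1 (H01 v) * epos v))%:E)%E.
    rewrite (split2 (G \o H01))//; [by rewrite /K (tr T1)|by move=> v; exact: G0|..].
    - exact: excess_neg_ge0.
    - exact: excess_pos_ge0.
  transitivity (\int[leb]_(v in `]0%R, 1%R[)
      (\1_S (q v) + (T2 (H01 v) * epos v + T1 (H01 v) * eneg v))%:E)%E; last first.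
    rewrite (split2 (fun v => \1_S (q v)))//; first by rewrite /K (tr T2).
    - exact: excess_pos_ge0.
    - exact: excess_neg_ge0.
  apply: ge0_ae_eq_integral => //.
  - exact: (msum (G \o H01)).
  - exact: (msum (fun v => \1_S (q v))).
  - move=> v _; rewrite lee_fin; apply: addr_ge0; first exact: G0.
    by apply: addr_ge0; apply: mulr_ge0 => //; [exact: excess_neg_ge0|exact: excess_pos_ge0].
  - move=> v _; rewrite lee_fin; apply: addr_ge0 => //.
    by apply: addr_ge0; apply: mulr_ge0 => //; [exact: excess_pos_ge0|exact: excess_neg_ge0].
  - apply: (ae_lebesgue_except2 (a := nu) (b := nup)) => v vnu vnup.
    by rewrite /= in_itv/= => v01; rewrite key.
transitivity (\int[leb]_(v in `]0%R, 1%R[) (\1_S (q v))%:E)%E.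
  by rewrite -[LHS](addeK _ Kfin) main addeK.
rewrite -(@integral_rquantile R F (fun x => (\1_S x)%:E))//.
- by rewrite integral_indic// setIT.
- exact/measurable_EFinP/measurable_indic.
Qed.

End residual.

(** * Rotation sequences *)

Section uniform_pair.
Context d (T : measurableType d) (R : realType) (P : probability T R).
Local Notation leb := (@lebesgue_measure R).
Local Notation unif := (uniform_prob (@ltr01 R)).
Local Notation RR := (measurableTypeR R).

Let mk (z : RR * RR) : 2.-tuple RR := [tuple z.1; z.2].

Let mmk : measurable_fun setT mk.
Proof.
apply/measurable_fun_tnthP => i.
have [->|i0] := eqVneq i ord0; first exact: measurable_fst.
rewrite (_ : _ \o _ = snd); first exact: measurable_snd.
by apply/funext => z; rewrite /= (tnth_nth 0)/=; case: i i0 => -[|[|]].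
Qed.

Let mk' : {mfun (RR * RR)%type >-> 2.-tuple RR} :=
  HB.pack mk (isMeasurableFun.Build _ _ _ _ _ mmk).

(** A single two-dimensional vector with the product of uniform laws is requested, so independence
    of its coordinates is contained in its law. Tonelli turns it into the iterated integral, the
    only form used later. *)
Lemma uniform_pair_exists : generates_independent_vectors P ->
  exists V : T -> R, exists U : T -> R,
    [/\ measurable_fun setT V, measurable_fun setT U &
    forall h : R -> R -> \bar R,
      measurable_fun setT (fun z : RR * RR => h z.1 z.2) -> (forall v u, 0 <= h v u)%E ->
      (\int[P]_w h (V w) (U w) =
       \int[leb]_(v in `]0%R, 1%R[) \int[leb]_(u in `]0%R, 1%R[) h v u)%E].
Proof.
move=> /(_ 1 (fun=> 2) (fun=> distribution (unif \x unif)%E mk'))[W [mW WQ _]].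
exists (fun w => tnth (W ord0 w) ord0), (fun w => tnth (W ord0 w) ord_max).
have mV : measurable_fun setT (fun w => tnth (W ord0 w) ord0 : RR).
  exact: measurableT_comp (measurable_tnth _) (mW ord0).
have mU : measurable_fun setT (fun w => tnth (W ord0 w) ord_max : RR).
  exact: measurableT_comp (measurable_tnth _) (mW ord0).
split => // h mh h0.
pose g (t : 2.-tuple RR) := h (tnth t ord0) (tnth t ord_max).
have mg : measurable_fun setT g.
  have mpr : measurable_fun setT (fun t : 2.-tuple RR => (tnth t ord0, tnth t ord_max)).
    by apply: measurable_fun_pair; exact: measurable_tnth.
  exact: (measurableT_comp mh mpr).
pose W' : {mfun T >-> 2.-tuple RR} :=
  HB.pack (W ord0) (isMeasurableFun.Build _ _ _ _ _ (mW ord0)).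
transitivity (\int[distribution P W']_t g t)%E.
  by rewrite ge0_integral_distribution// => t; exact: h0.
transitivity (\int[distribution (unif \x unif)%E mk']_t g t)%E.
  by apply: eq_measure_integral => E mE _; exact: WQ.
rewrite ge0_integral_distribution//=; last by move=> t; exact: h0.
rewrite fubini_tonelli1//; last by move=> z; exact: h0.
have mh' : measurable_fun setT (fun z : RR * RR => g (mk z)) by exact: mh.
rewrite integral_uniform01; last 2 first.
- by apply: measurable_fun_fubini_tonelli_F => // z; exact: h0.
- by move=> v; apply: integral_ge0 => u _; exact: h0.
apply: eq_integral => v _; rewrite /fubini_F integral_uniform01//.
- exact: (measurableT_comp mh' (pair1_measurable v)).
- by move=> u; exact: h0.
Qed.

End uniform_pair.

Section rotation.
Variable R : realType.
Implicit Types (u x p : R) (i n : nat).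
Local Notation leb := (@lebesgue_measure R).

Definition rfloor x : R := (Num.floor x)%:~R.

Lemma rfloor_nd : nondecreasing_fun rfloor.
Proof. by move=> x y xy; rewrite ler_int le_floor. Qed.

Lemma measurable_rfloor : measurable_fun setT rfloor.
Proof. exact: nondecreasing_measurable rfloor_nd. Qed.

Lemma rfloor_le x : rfloor x <= x. Proof. exact: floor_le. Qed.

Lemma rfloor_gt x : x < rfloor x + 1.
Proof. by have := floorD1_gt x; rewrite intrD. Qed.

Lemma rfloor_ge0 x : 0 <= x -> 0 <= rfloor x.
Proof. by move=> x0; rewrite ler0z floor_ge0. Qed.

Lemma rfloor01 u : 0 < u < 1 -> rfloor u = 0.
Proof.
move=> /andP[u0 u1]; rewrite /rfloor (_ : Num.floor u = 0)//.
by apply/floor_def; rewrite add0r (ltW u0).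
Qed.

(** The coding of the rotation by [p] started at [u]: for [p] in [0, 1], the bit is 1 when the step
    from [u + i p] to [u + (i + 1) p] reaches a new integer. *)
Definition rotation_bit p i u : R := rfloor (u + i.+1%:R * p) - rfloor (u + i%:R * p).

Lemma rotation_bit01 p i u : 0 <= p <= 1 ->
  rotation_bit p i u = 0 \/ rotation_bit p i u = 1.
Proof.
move=> /andP[p0 p1]; rewrite /rotation_bit -natr1 mulrDl mul1r addrA.
set x := u + i%:R * p; rewrite /rfloor -intrB.
set k := _ - _; have k0 : (0 <= k)%R by rewrite subr_ge0 le_floor// lerDl.
have : k < 2.
  rewrite ltrBlDr -(ltr_int R) intrD (le_lt_trans (floor_le _))//.
  have := rfloor_gt x; rewrite /rfloor; lra.
by case: k k0 => [[|[|]]|]//= _ _; [left|right].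
Qed.

Lemma sum_rotation_bit p n u :
  \sum_(i < n) rotation_bit p i u = rfloor (u + n%:R * p) - rfloor u.
Proof.
elim: n => [|n ih]; first by rewrite big_ord0 mul0r addr0 subrr.
by rewrite big_ord_recr/= ih /rotation_bit addrC addrA subrK.
Qed.

Lemma rotation_dev x u : `|rfloor (u + x) - rfloor u - x| <= 1.
Proof.
have := rfloor_gt u; have := rfloor_gt (u + x).
have := rfloor_le u; have := rfloor_le (u + x).
by rewrite ler_norml => ? ? ? ?; apply/andP; split; lra.
Qed.

Lemma integral_rfloor_shift (phi : R -> R) x : (forall z, 0 <= phi z) ->
  measurable_fun setT phi ->
  (\int[leb]_(u in `]0%R, 1%R[) (phi (rfloor (u + x)))%:E =
   ((1 - (x - rfloor x)) * phi (rfloor x) + (x - rfloor x) * phi (rfloor x + 1))%:E)%E.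
Proof.
move=> phi0 mphi; rewrite integral_itv_obnd_cbnd; last first.
  apply: measurable_funTS; apply/measurable_EFinP; apply: measurableT_comp => //.
  by apply: measurableT_comp; [exact: measurable_rfloor|exact: measurable_funD].
rewrite (integral_floor_shift (phi := fun z => phi z%:~R))//.
by rewrite intrD.
Qed.

Lemma integral_rfloor x : 0 <= x ->
  (\int[leb]_(u in `]0%R, 1%R[) (rfloor (u + x))%:E = x%:E)%E.
Proof.
(* The floor is nonnegative here; the absolute value only makes the test function nonnegative
   everywhere. *)
move=> x0; transitivity (\int[leb]_(u in `]0%R, 1%R[) (`|rfloor (u + x)|)%:E)%E.
  apply: eq_integral => u; rewrite inE/= in_itv/= => /andP[u0 u1].
  by rewrite ger0_norm// rfloor_ge0// addr_ge0// ltW.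
rewrite (integral_rfloor_shift (phi := Num.norm))//.
rewrite !ger0_norm ?addr_ge0 ?rfloor_ge0//; congr EFin; ring.
Qed.

Lemma integral_rotation_dev2 x :
  (\int[leb]_(u in `]0%R, 1%R[) ((rfloor (u + x) - x) ^+ 2)%:E <= (4^-1)%:E)%E.
Proof.
rewrite (integral_rfloor_shift (phi := fun z => (z - x) ^+ 2))//; last 2 first.
- by move=> z; exact: sqr_ge0.
- by apply: measurable_funX; exact: measurable_funB.
rewrite lee_fin; set f := x - rfloor x.
rewrite (_ : _ + _ = f * (1 - f)); last by rewrite /f; ring.
(* The variance of a Bernoulli variable is largest at 1/2, which is the origin of the factor 1/4. *)
by have := sqr_ge0 (f - 2^-1); nra.
Qed.

Lemma integral_scaled_rotation_dev2 g x :
  (\int[leb]_(u in `]0%R, 1%R[) ((g * (rfloor (u + x) - rfloor u - x)) ^+ 2)%:E <=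
   (4^-1 * g ^+ 2)%:E)%E.
Proof.
have mr : measurable_fun setT (fun u : R => (rfloor (u + x) - x) ^+ 2).
  apply: measurable_funX; apply: measurable_funB => //.
  by apply: measurableT_comp measurable_rfloor _; exact: measurable_funD.
have -> : (\int[leb]_(u in `]0%R, 1%R[) ((g * (rfloor (u + x) - rfloor u - x)) ^+ 2)%:E =
    \int[leb]_(u in `]0%R, 1%R[) ((g ^+ 2)%:E * ((rfloor (u + x) - x) ^+ 2)%:E))%E.
  apply: eq_integral => u; rewrite inE/= in_itv/= => /rfloor01 u0.
  by rewrite u0 subr0 exprMn EFinM.
rewrite ge0_integralZl_EFin//; last 3 first.
- by move=> u _; rewrite lee_fin sqr_ge0.
- by apply/measurable_EFinP; exact: measurable_funTS.
- exact: sqr_ge0.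
rewrite (_ : (4^-1 * g ^+ 2)%:E = (g ^+ 2)%:E * (4^-1)%:E)%E; last by rewrite -EFinM mulrC.
apply: lee_wpmul2l; first by rewrite lee_fin sqr_ge0.
exact: integral_rotation_dev2.
Qed.

Lemma measurable_rotation_bit p i : measurable_fun setT (rotation_bit p i).
Proof.
by apply: measurable_funB; apply: measurableT_comp measurable_rfloor _;
  apply: measurable_funD.
Qed.

Lemma rotation_bit_ge0 p i u : 0 <= p <= 1 -> 0 <= rotation_bit p i u.
Proof. by move=> /rotation_bit01 => /(_ i u)[] ->. Qed.

Lemma rotation_bit_le1 p i u : 0 <= p <= 1 -> rotation_bit p i u <= 1.
Proof. by move=> /rotation_bit01 => /(_ i u)[] ->. Qed.

(** The floor of [u + x] has mean [x], so the increment has mean [(i + 1) p - i p]. The identity is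
    first proved as a sum of nonnegative integrands. *)
Lemma integral_rotation_bit p i : 0 <= p <= 1 ->
  (\int[leb]_(u in `]0%R, 1%R[) (rotation_bit p i u)%:E = p%:E)%E.
Proof.
move=> /[dup] p01 /andP[p0 p1].
have h : (\int[leb]_(u in `]0%R, 1%R[) (rotation_bit p i u)%:E +
   \int[leb]_(u in `]0%R, 1%R[) (rfloor (u + i%:R * p))%:E =
   \int[leb]_(u in `]0%R, 1%R[) (rfloor (u + i.+1%:R * p))%:E)%E.
  rewrite -ge0_integralD//.
  - by apply: eq_integral => u _; rewrite -EFinD subrK.
  - by move=> u _; rewrite lee_fin rotation_bit_ge0.
  - by apply: measurable_funTS; apply/measurable_EFinP; exact: measurable_rotation_bit.
  - move=> u /=; rewrite in_itv/= => /andP[/ltW u0 _].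
    by rewrite lee_fin rfloor_ge0// addr_ge0// mulr_ge0.
  - apply: measurable_funTS; apply/measurable_EFinP.
    by apply: measurableT_comp measurable_rfloor _; exact: measurable_funD.
move: h; rewrite !integral_rfloor ?mulr_ge0// => h.
have fin : (i%:R * p)%:E \is a fin_num by [].
by rewrite -[LHS](addeK _ fin) h -EFinB -natr1; congr EFin; ring.
Qed.

Lemma integral_rotation_mixture p i a b : 0 <= p <= 1 -> 0 <= a -> 0 <= b ->
  (\int[leb]_(u in `]0%R, 1%R[)
     ((1 - rotation_bit p i u) * a + rotation_bit p i u * b)%:E =
   ((1 - p) * a + p * b)%:E)%E.
Proof.
move=> p01 a0 b0.
have mbit : measurable_fun (`]0, 1[ : set R) (fun u => (rotation_bit p i u)%:E).
  by apply: measurable_funTS; apply/measurable_EFinP; exact: measurable_rotation_bit.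
have mbit' : measurable_fun (`]0, 1[ : set R) (fun u => (1 - rotation_bit p i u)%:E).
  apply: measurable_funTS; apply/measurable_EFinP; apply: measurable_funB => //.
  exact: measurable_rotation_bit.
have b0' u : (0 <= (rotation_bit p i u)%:E)%E by rewrite lee_fin rotation_bit_ge0.
have b1' u : (0 <= (1 - rotation_bit p i u)%:E)%E.
  by rewrite lee_fin subr_ge0 rotation_bit_le1.
have J : (\int[leb]_(u in `]0%R, 1%R[) (1 - rotation_bit p i u)%:E = (1 - p)%:E)%E.
  have h : (\int[leb]_(u in `]0%R, 1%R[) (1 - rotation_bit p i u)%:E + p%:E = 1%:E)%E.
    rewrite -[X in (_ + X)%E](integral_rotation_bit i p01) -ge0_integralD//.
    rewrite (eq_integral (cst 1%:E)); last by move=> u _; rewrite -EFinD subrK.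
    by rewrite integral_cst//= lebesgue_measure_itv/= lte_fin ltr01 sube0 mule1.
  have fin : p%:E \is a fin_num by [].
  by rewrite -[LHS](addeK _ fin) h.
under eq_integral do rewrite EFinD !EFinM.
rewrite ge0_integralD//; last 4 first.
- by move=> u _; rewrite mule_ge0.
- by apply: emeasurable_funM.
- by move=> u _; rewrite mule_ge0.
- by apply: emeasurable_funM.
by rewrite !ge0_integralZr// J integral_rotation_bit// EFinD !EFinM.
Qed.

End rotation.

(** * Sums of identically distributed variables *)

Lemma variance_integral d (T : measurableType d) (R : realType) (P : probability T R) (f : T -> R) :
  ('V_P[f] = \int[P]_w ((f w - fine 'E_P[f])%R ^+ 2)%:E)%E.
Proof. by rewrite /variance covariance.unlock expectation.unlock. Qed.

Section has_df.
Context d (T : measurableType d) (R : realType) (P : probability T R).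
Variables (F : cumulativeBounded (0 : R) 1) (X : {RV P >-> R}).
Hypothesis XF : has_df X F.
Local Notation lsf := (lebesgue_stieltjes_measure F).

Lemma ge0_integral_has_df (g : R -> \bar R) :
  measurable_fun setT g -> (forall x, 0 <= g x)%E ->
  (\int[P]_w g (X w) = \int[lsf]_x g x)%E.
Proof.
move=> mg g0; apply: (ge0_integral_law (P := P) (X := X) (m := lsf)) => //.
- by transitivity (1%:E : \bar R); [|apply/esym]; exact: probability_setT.
- by rewrite (le_lt_trans (probability_le1 P measurableT))// ltry.
- by move=> x; transitivity ((F x)%:E); [exact: XF|exact/esym/lebesgue_stieltjesNyc].
Qed.

Hypothesis F_mean : has_finite_mean F.

Lemma has_df_Lfun1 : (X : T -> R) \in Lfun P 1.
Proof.
apply/Lfun1_integrable/integrableP; split; first exact/measurable_EFinP.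
have /integrableP[_] := F_mean.
by rewrite -(ge0_integral_has_df (g := fun x => `|x%:E|%E))//; exact: measurableT_comp.
Qed.

Lemma has_df_expectation : ('E_P[X] = (mean F)%:E)%E.
Proof.
have mE : measurable_fun [set: R] (EFin : R -> \bar R) by exact: EFin_measurable.
rewrite expectation_def /mean /Rintegral fineK; last exact: integrable_fin_num.
etransitivity; first exact: integralE.
apply/esym; etransitivity; first exact: integralE.
apply/esym; congr (_ - _)%E.
  rewrite -(ge0_integral_has_df (measurable_funepos mE))//.
  by apply: eq_integral => t _; rewrite !funeposE.
rewrite -(ge0_integral_has_df (measurable_funeneg mE))//.
by apply: eq_integral => t _; rewrite !funenegE.
Qed.

(** The right side involves [F] alone, so all variables with this distribution share one variance,
    possibly infinite. The comparison with competing sequences rests on this. *)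
Lemma has_df_variance : ('V_P[X] = \int[lsf]_x ((x - mean F)%R ^+ 2)%:E)%E.
Proof.
rewrite variance_integral has_df_expectation/=.
apply: (ge0_integral_has_df (g := fun x => ((x - mean F) ^+ 2)%:E)).
  by apply/measurable_EFinP; apply: measurable_funX; exact: measurable_funB.
by move=> x; rewrite lee_fin sqr_ge0.
Qed.

End has_df.

Section partial_sum.
Context d (T : measurableType d) (R : realType) (P : probability T R).
Variables (F : cumulativeBounded (0 : R) 1) (X : nat -> {RV P >-> R}).
Hypotheses (XF : forall i, has_df (X i) F) (F_mean : has_finite_mean F).

Lemma partial_sum_expectation n : partial_sum X n \in Lfun P 1 /\
  ('E_P[partial_sum X n] = (n%:R * mean F)%:E)%E.
Proof.
elim: n => [|n [ihL ihE]].
  rewrite (_ : partial_sum X 0 = cst 0); last by apply/funext => w; rewrite /partial_sum big_ord0.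
  by rewrite expectation_cst mul0r Lfun_cst.
rewrite (_ : partial_sum X n.+1 = partial_sum X n \+ X n); last first.
  by apply/funext => w; rewrite /partial_sum big_ord_recr.
have XL := has_df_Lfun1 (XF n) F_mean.
split; first exact: rpredD.
rewrite expectationD// ihE (has_df_expectation (XF n) F_mean) -EFinD.
by rewrite -natr1 mulrDl mul1r.
Qed.

Lemma partial_sum1 : partial_sum X 1 = X 0%N.
Proof. by apply/funext => w; rewrite /partial_sum big_ord1. Qed.

Lemma partial_sum_variance n : ('V_P[partial_sum X n] =
  \int[P]_w ((partial_sum X n w - n%:R * mean F)%R ^+ 2)%:E)%E.
Proof. by rewrite variance_integral (partial_sum_expectation n).2. Qed.

End partial_sum.

Lemma cvg_bounded_div (R : realType) (M : R) (x k : nat -> R) :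
  (forall n, `|x n| <= M) -> k n @[n --> \oo] --> +oo ->
  x n / k n @[n --> \oo] --> (0 : R).
Proof.
move=> xM koo.
have kpos : \forall n \near \oo, 0 < k n by move/cvgryPgt : koo; exact.
have M0 : 0 <= M by rewrite (le_trans _ (xM 0%N)).
have kV : M * (k n)^-1 @[n --> \oo] --> 0.
  rewrite -(mulr0 M); apply: cvgMl_tmp.
  exact/(gtr0_cvgV0 kpos).
apply/norm_cvg0P.
apply: (squeeze_cvgr _ (cvg_cst 0) kV).
near=> n; rewrite normr_ge0/= normrM ler_pM//.
by rewrite normfV gtr0_norm//; near: n.
Unshelve. all: by end_near. Qed.

(** * Distributions of functions of the uniform pair *)

Section pair_law.
Context d (T : measurableType d) (R : realType) (P : probability T R).
Variables (V U : T -> R).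
Hypotheses (mV : measurable_fun setT V) (mU : measurable_fun setT U).
Local Notation RR := (measurableTypeR R).
Local Notation leb := (@lebesgue_measure R).
Local Notation unif := (uniform_prob (@ltr01 R)).
Hypothesis VU : forall h : R -> R -> \bar R,
  measurable_fun setT (fun z : RR * RR => h z.1 z.2) -> (forall v u, 0 <= h v u)%E ->
  (\int[P]_w h (V w) (U w) =
   \int[leb]_(v in `]0%R, 1%R[) \int[leb]_(u in `]0%R, 1%R[) h v u)%E.

Lemma pair_law_preimage (f : R -> R -> R) (S : set R) :
  measurable_fun setT (fun z : RR * RR => f z.1 z.2) -> measurable S ->
  P ((fun w => f (V w) (U w)) @^-1` S) =
  (\int[leb]_(v in `]0%R, 1%R[) \int[leb]_(u in `]0%R, 1%R[) (\1_S (f v u))%:E)%E.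
Proof.
move=> mf mS; rewrite -(VU (h := fun v u => (\1_S (f v u))%:E)); last 2 first.
- apply/measurable_EFinP.
  exact: (measurableT_comp (measurable_indic mS) mf).
- by move=> v u; rewrite lee_fin.
have mVU : measurable_fun setT (fun w => (V w, U w) : RR * RR) by exact: measurable_fun_pair.
have mfS : measurable ((fun w => f (V w) (U w)) @^-1` S).
  by rewrite -[X in measurable X]setTI; exact: (measurableT_comp mf mVU).
by rewrite -(setIT (_ @^-1` _)) -integral_indic.
Qed.

Lemma pair_law_fst (g : R -> R) (S : set R) : measurable_fun setT g -> measurable S ->
  P ((fun w => g (V w)) @^-1` S) = unif (g @^-1` S).
Proof.
move=> mg mS; rewrite (pair_law_preimage (f := fun v _ => g v))//; last first.
  exact: (measurableT_comp mg measurable_fst).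
have mgS : measurable (g @^-1` S) by rewrite -[X in measurable X]setTI; exact: mg.
rewrite (uniform01E mgS) setIC -integral_indic//.
apply: eq_integral => v _.
by rewrite integral_cst//= lebesgue_measure_itv/= lte_fin ltr01 sube0 mule1.
Qed.

End pair_law.

(** * The construction *)

Section construction.
Context d (T : measurableType d) (R : realType) (P : probability T R).
Variables (F : cumulativeBounded (0 : R) 1).
Hypothesis F_mean : has_finite_mean F.
Variables (V U : T -> R).
Hypotheses (mV : measurable_fun setT V) (mU : measurable_fun setT U).
Local Notation RR := (measurableTypeR R).
Local Notation leb := (@lebesgue_measure R).
Local Notation unif := (uniform_prob (@ltr01 R)).
Hypothesis VU : forall h : R -> R -> \bar R,
  measurable_fun setT (fun z : RR * RR => h z.1 z.2) -> (forall v u, 0 <= h v u)%E ->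
  (\int[P]_w h (V w) (U w) =
   \int[leb]_(v in `]0%R, 1%R[) \int[leb]_(u in `]0%R, 1%R[) h v u)%E.
Local Notation mu := (mean F).
Local Notation H01 := (excess_int01 F).
Local Notation lo := (dev_lo F).
Local Notation hi := (dev_hi F).
Local Notation gap := (dev_gap F).
Local Notation p := (hi_prob F).

Definition rotation_var i (v u : R) :=
  mu + lo (H01 v) + gap (H01 v) * rotation_bit (p (H01 v)) i u.

(** The bit is 0 or 1, so any function of the variable is affine in the bit. Averaging over [u] then
    merely replaces the bit by its mean. *)
Lemma rotation_var_mixture i v u (phi : R -> R) :
  phi (rotation_var i v u) =
  (1 - rotation_bit (p (H01 v)) i u) * phi (mu + lo (H01 v)) +
  rotation_bit (p (H01 v)) i u * phi (mu + hi (H01 v)).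
Proof.
have p01 : 0 <= p (H01 v) <= 1 by rewrite hi_prob_ge0// hi_prob_le1.
rewrite /rotation_var dev_hi_lo addrA.
have [->|->] := rotation_bit01 i u p01.
  by rewrite mulr0 addr0 subr0 mul1r mul0r addr0.
by rewrite mulr1 subrr mul0r mul1r add0r.
Qed.

(** The term [n * lo] cancels against [n * p * gap] by [hi_prob_gap], leaving the gap times the
    discrepancy of the rotation. *)
Lemma sum_rotation_var n v u :
  \sum_(i < n) rotation_var i v u - n%:R * mu =
  gap (H01 v) * (rfloor (u + n%:R * p (H01 v)) - rfloor u - n%:R * p (H01 v)).
Proof.
rewrite /rotation_var big_split/= -big_distrr/= sum_rotation_bit.
rewrite sumr_const card_ord -mulr_natl.
have := hi_prob_gap F_mean (H01 v).
set a := p _; set b := gap _; set l := lo _ => E.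
have -> : l = - (a * b) by rewrite E opprK.
ring.
Qed.

Lemma measurable_rotation_var i :
  measurable_fun setT (fun z : RR * RR => rotation_var i z.1 z.2).
Proof.
have mH : measurable_fun setT (fun z : RR * RR => H01 z.1).
  exact: measurableT_comp (measurable_excess_int01 F_mean) measurable_fst.
have mp := measurableT_comp (measurable_hi_prob F_mean) mH.
have mfl k : measurable_fun setT
    (fun z : RR * RR => rfloor (z.2 + k%:R * p (H01 z.1))).
  apply: measurableT_comp (@measurable_rfloor R) _.
  by apply: measurable_funD => //; exact: measurable_funM.
apply: measurable_funD; first apply: measurable_funD => //.
  exact: measurableT_comp (measurable_dev_lo F_mean) mH.
apply: measurable_funM; last exact: measurable_funB.
exact: measurableT_comp (measurable_dev_gap F_mean) mH.
Qed.

Let mVU : measurable_fun setT (fun w => (V w, U w) : RR * RR).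
Proof. exact: measurable_fun_pair. Qed.

Let mX i : measurable_fun setT (fun w => rotation_var i (V w) (U w)).
Proof. exact: (measurableT_comp (measurable_rotation_var i) mVU). Qed.

Let mZ : measurable_fun setT (fun w => gap (H01 (V w))).
Proof.
apply: measurableT_comp (measurable_dev_gap F_mean) _.
exact: measurableT_comp (measurable_excess_int01 F_mean) mV.
Qed.

Definition rotation_rv i : {RV P >-> R} :=
  HB.pack (fun w => rotation_var i (V w) (U w)) (isMeasurableFun.Build _ _ _ _ _ (mX i)).

Definition gap_rv : {RV P >-> R} :=
  HB.pack (fun w => gap (H01 (V w))) (isMeasurableFun.Build _ _ _ _ _ mZ).

(** Integrating over [u] turns the bit into [hi_prob], whatever [i] is; integrating over [v] is then
    [integral_mixture]. *)
Lemma rotation_rv_df i : has_df (rotation_rv i) F.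
Proof.
move=> x; have mS : measurable (`]-oo, x]%classic : set R) by exact: measurable_itv.
transitivity (lebesgue_stieltjes_measure F `]-oo, x]%classic);
  last exact: lebesgue_stieltjesNyc.
transitivity (P ((fun w => rotation_var i (V w) (U w)) @^-1` `]-oo, x])) => //.
rewrite (pair_law_preimage mV mU VU (measurable_rotation_var i) mS).
rewrite -(integral_mixture F_mean mS); apply: eq_integral => v _.
under eq_integral do rewrite (rotation_var_mixture _ _ _ (\1_(`]-oo, x]) : R -> R)).
by rewrite integral_rotation_mixture// hi_prob_ge0// hi_prob_le1.
Qed.

Let measurable_gap_H : measurable_fun setT (gap \o H01).
Proof.
exact: measurableT_comp (measurable_dev_gap F_mean) (measurable_excess_int01 F_mean).
Qed.

Lemma gap_rv_df : has_df gap_rv (residual_df F).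
Proof.
move=> x; have mS : measurable (`]-oo, x]%classic : set R) by exact: measurable_itv.
transitivity (P ((fun w => (gap \o H01) (V w)) @^-1` `]-oo, x])) => //.
by rewrite (pair_law_fst mV mU VU measurable_gap_H mS) residual_df_law.
Qed.

Lemma gap_rv_expectation2 : ('E_P[fun w => (gap_rv w ^+ 2)%R] =
  \int[leb]_(v in `]0%R, 1%R[) (gap (H01 v) ^+ 2)%:E)%E.
Proof.
have mg := measurable_gap_H.
rewrite unlock/= (VU (h := fun v u => (gap (H01 v) ^+ 2)%:E)); last 2 first.
- apply/measurable_EFinP/measurable_funX; exact: measurableT_comp mg measurable_fst.
- by move=> v u; rewrite lee_fin sqr_ge0.
apply: eq_integral => v _.
by rewrite integral_cst//= lebesgue_measure_itv/= lte_fin ltr01 sube0 mule1.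
Qed.

Lemma rotation_rv_variance_le n :
  ('V_P[partial_sum rotation_rv n] <= (4^-1)%:E * 'E_P[fun w => (gap_rv w ^+ 2)%R])%E.
Proof.
rewrite (partial_sum_variance rotation_rv_df F_mean) gap_rv_expectation2.
have mg := measurable_gap_H.
pose D (v u : R) : R := gap (H01 v) * (rfloor (u + n%:R * p (H01 v)) - rfloor u - n%:R * p (H01 v)).
have mD : measurable_fun setT (fun z : RR * RR => (D z.1 z.2 ^+ 2)%:E).
  have mH : measurable_fun setT (fun z : RR * RR => H01 z.1).
    exact: measurableT_comp (measurable_excess_int01 F_mean) measurable_fst.
  have mp := measurableT_comp (measurable_hi_prob F_mean) mH.
  apply/measurable_EFinP; apply: measurable_funX; apply: measurable_funM.
    exact: measurableT_comp (measurable_dev_gap F_mean) mH.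
  apply: measurable_funB; last exact: measurable_funM.
  apply: measurable_funB; apply: measurableT_comp (@measurable_rfloor R) _ => //.
  by apply: measurable_funD => //; exact: measurable_funM.
have D0 v u : (0 <= (D v u ^+ 2)%:E)%E by rewrite lee_fin sqr_ge0.
under eq_integral do rewrite sum_rotation_var.
rewrite (VU (h := fun v u => (D v u ^+ 2)%:E))// -ge0_integralZl//; last 2 first.
- by apply/measurable_EFinP/measurable_funTS; exact: measurable_funX.
- by move=> v _; rewrite lee_fin sqr_ge0.
apply: ge0_le_integral => //.
- by move=> v _; apply: integral_ge0.
(* Tonelli gives measurability of the inner integral once Lebesgue measure on ]0, 1[ is written as
   the uniform law on the line. *)
- rewrite (_ : (fun v => _) =
      fubini_F unif (fun z : RR * RR => (D z.1 z.2 ^+ 2)%:E)); last first.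
    apply/funext => v; rewrite /fubini_F integral_uniform01//.
    exact: (measurableT_comp mD (pair1_measurable v)).
  by apply: measurable_funTS; apply: measurable_fun_fubini_tonelli_F.
- by apply/measurable_funTS/measurable_funeM/measurable_EFinP; exact: measurable_funX.
by move=> v _; rewrite -EFinM; exact: integral_scaled_rotation_dev2.
Qed.

Lemma partial_sum_rotation_rv_dev n w :
  `|partial_sum rotation_rv n w - n%:R * mu| <= gap_rv w.
Proof.
rewrite /partial_sum sum_rotation_var normrM ger0_norm ?dev_gap_ge0//.
by rewrite ler_piMr ?dev_gap_ge0// rotation_dev.
Qed.

End construction.

(** * Second moment of the residual variable, and bounded support *)

Lemma expectation_sqr_lty d (T : measurableType d) (R : realType)
    (P : probability T R) (G : R -> R) (X : {RV P >-> R}) :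
  has_df X G -> ('V_(law_of_df G)[idfun] < +oo)%E ->
  ('E_P[fun w => (X w ^+ 2)%R] < +oo)%E.
Proof.
move=> XG; rewrite variance_integral; set m := fine _ => Vlt.
have mXm : measurable_fun setT (fun w => (X w - m) ^+ 2).
  by apply: measurable_funX; exact: measurable_funB.
have mxm : measurable_fun setT (fun x : R => ((x - m) ^+ 2)%:E).
  by apply/measurable_EFinP; apply: measurable_funX; exact: measurable_funB.
have XE : (\int[P]_w ((X w - m) ^+ 2)%:E = \int[law_of_df G]_x ((x - m) ^+ 2)%:E)%E.
  apply: (@ge0_integral_law _ T R P X (law_of_df G) _ _ _ _
    (fun x : R => ((x - m) ^+ 2)%:E)) => //.
  - by transitivity (1%:E : \bar R); [|apply/esym]; exact: probability_setT.
  - by rewrite (le_lt_trans (probability_le1 P measurableT))// ltry.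
  - by move=> x; apply: law_of_df_preimage => //; exact: measurable_itv.
  - by move=> x; rewrite lee_fin sqr_ge0.
rewrite expectation.unlock.
apply: (@le_lt_trans _ _ (\int[P]_w (2%:E * ((X w - m) ^+ 2)%:E + (2 * m ^+ 2)%:E))%E).
  apply: ge0_le_integral => //.
  - by move=> w _; rewrite lee_fin sqr_ge0.
  - by apply/measurable_EFinP; exact: measurable_funX.
  - apply: emeasurable_funD => //; apply/measurable_funeM.
    exact/measurable_EFinP.
  - move=> w _; rewrite -EFinM -EFinD lee_fin.
    (* The difference of the two sides is [(X w - 2 * m) ^+ 2], so the bound holds for any real [m],
       in particular for [fine] of the expectation. *)
    by have := sqr_ge0 (X w - 2 * m); nra.
rewrite ge0_integralD//; last 3 first.
- by move=> w _; rewrite mule_ge0// lee_fin sqr_ge0.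
- by apply/measurable_funeM/measurable_EFinP.
- by move=> w _; rewrite lee_fin mulr_ge0// sqr_ge0.
rewrite ge0_integralZl_EFin//; last 2 first.
- by move=> w _; rewrite lee_fin sqr_ge0.
- exact/measurable_EFinP.
rewrite XE integral_cst//; apply: lte_add_pinfty.
  by rewrite lte_mul_pinfty.
rewrite lte_mul_pinfty//; first by rewrite lee_fin mulr_ge0// sqr_ge0.
by rewrite (le_lt_trans (probability_le1 P measurableT))// ltry.
Qed.

(** If [q t] were below [a], the ray up to [q t] would be disjoint from [a, b] and have mass at
    least [t > 0], pushing the total above 1. *)
Lemma rquantile_in_support (R : realType) (F : cumulativeBounded (0 : R) 1) (a b t : R) :
  lebesgue_stieltjes_measure F `[a, b] = 1%E -> 0 < t < 1 -> a <= rquantile F t <= b.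
Proof.
move=> Fab t01; have [t0 t1] := andP t01.
have Fb : F b = 1.
  apply/le_anti; rewrite df_le1/= -lee_fin -Fab -lebesgue_stieltjesNyc.
  apply: le_measure; rewrite ?inE; [exact: measurable_itv|exact: measurable_itv|].
  exact: subset_itvr.
rewrite (rquantile_le F b t01) Fb (ltW t1) andbT leNgt; apply/negP => qa.
set x := rquantile F t in qa.
have xab : (lebesgue_stieltjes_measure F (`]-oo, x] `|` `[a, b]) = (F x)%:E + 1%:E)%E.
  etransitivity.
    apply: measureU; [exact: measurable_itv|exact: measurable_itv|].
    apply/seteqP; split => // z /=; rewrite !in_itv/= => -[zx /andP[az _]].
    by move: qa; rewrite ltNge (le_trans az).
  by congr (_ + _)%E; [exact: lebesgue_stieltjesNyc|exact: Fab].
have : (lebesgue_stieltjes_measure F (`]-oo, x] `|` `[a, b]) <= 1%:E)%E.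
  by apply: probability_le1; apply: measurableU; exact: measurable_itv.
rewrite xab -EFinD lee_fin gerDr leNgt => /negP; apply.
by rewrite (lt_le_trans t0)// -rquantile_le.
Qed.

Lemma dev_gap_le_support (R : realType) (F : cumulativeBounded (0 : R) 1)
    (F_mean : has_finite_mean F) (a b y : R) :
  lebesgue_stieltjes_measure F `[a, b] = 1%E -> dev_gap F y <= b - a.
Proof.
move=> Fab; rewrite /dev_gap /dev_hi /dev_lo; case: ifPn => [/andP[cy y0]|_].
  have [A0 Anu _] := res_AP F_mean cy (ltW y0).
  have [B0 B1 _] := res_BP F_mean cy (ltW y0).
  have A01 : 0 < res_A F y < 1.
    rewrite res_A_gt0//= (lt_le_trans Anu)//.
    exact: le_trans (nu_le_nup F) (nup_le1 F).
  have B01 : 0 < res_B F y < 1.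
    by rewrite res_B_lt1// (le_lt_trans (df_ge0 F (mean F))).
  have /andP[aA _] := rquantile_in_support Fab A01.
  have /andP[_ bB] := rquantile_in_support Fab B01.
  by rewrite /excess; lra.
(* Off ]c, 0[ the gap is 0 and [a <= b] is what remains; any quantile, here the median, lies between
   them. *)
have t01 : 0 < (2^-1 : R) < 1 by apply/andP; split; lra.
by have /andP[aq qb] := rquantile_in_support Fab t01; lra.
Qed.

Theorem proposition2p6 (d : measure_display) (T : measurableType d)
    (R : realType) (P : probability T R)
    (P_atomless : atomless P) (P_gen : generates_independent_vectors P)
    (F : cumulativeBounded (0 : R) 1) (F_mean : has_finite_mean F)
    (Ft_var : ('V_(law_of_df (residual_df F))[idfun] < +oo)%E) :
  exists (X : nat -> {RV P >-> R}) (Z : {RV P >-> R}),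
    (forall i, has_df (X i) F) /\ has_df Z (residual_df F) /\
    (forall n, ('V_P[partial_sum X n] <= (4^-1)%:E * 'E_P[fun w => (Z w ^+ 2)%R])%E) /\
    (forall a b : R, lebesgue_stieltjes_measure F `[a, b] = 1%E ->
       forall n, ('V_P[partial_sum X n] <= ((b - a) ^+ 2 / 4)%:E)%E) /\
    ((lebesgue_stieltjes_measure F).-integrable setT
       (fun x : R => (x ^+ 3)%:E) ->
     exists C : R, forall n, ('V_P[partial_sum X n] <= C%:E)%E) /\
    ('V_P[X 0%N] = ((4^-1)%:E * 'E_P[fun w => (Z w ^+ 2)%R])%E -> SEND F X).
Proof.
have [V [U [mV mU VU]]] := uniform_pair_exists P_gen.
pose X := rotation_rv P F_mean mV mU; pose Z := gap_rv P F_mean mV.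
have XF i : has_df (X i) F by exact: rotation_rv_df.
have ZF : has_df Z (residual_df F) by exact: (gap_rv_df F_mean mV mU VU).
have varX n : ('V_P[partial_sum X n] <= (4^-1)%:E * 'E_P[fun w => (Z w ^+ 2)%R])%E.
  exact: rotation_rv_variance_le.
have EZfin : 'E_P[fun w => (Z w ^+ 2)%R]%E \is a fin_num.
  rewrite ge0_fin_numE ?(expectation_sqr_lty ZF)//.
  by apply: expectation_ge0 => w; exact: sqr_ge0.
have bounded : exists C : R, forall n, ('V_P[partial_sum X n] <= C%:E)%E.
  (* The constant E[Z^2]/4 is a real number by [EZfin]. *)
  exists (4^-1 * fine 'E_P[fun w => (Z w ^+ 2)%R]%E) => n.
  by rewrite EFinM fineK.
exists X, Z; split; [exact: XF|split; [exact: ZF|split; [exact: varX|]]].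
split; [|split; [by move=> _; exact: bounded|]].
  move=> a b Fab n; apply: (le_trans (varX n)).
  rewrite mulrC EFinM lee_wpmul2l ?lee_fin//.
  rewrite -[leRHS](expectation_cst P); apply: expectation_le => //.
  - exact: measurable_funX.
  - by move=> w; exact: sqr_ge0.
  - by move=> w; exact: sqr_ge0.
  - apply: aeW => w /=; rewrite lerXn2r ?nnegrE ?dev_gap_ge0//.
      (* Squaring needs [0 <= b - a], read off from the gap at an arbitrary point. *)
      by rewrite (le_trans (dev_gap_ge0 F_mean 0))// dev_gap_le_support.
    exact: dev_gap_le_support.
move=> varX0; split => //.
  move=> k koo; apply: aeW => w.
  (* For fixed [w] the deviations are bounded by [Z w] uniformly in [n], so convergence holds at
     every point. *)
  apply: (@cvg_bounded_div _ (Z w)) koo => n.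
  exact: partial_sum_rotation_rv_dev.
(* The supremum for [Y] is at least Var(Y_1) = Var(X_1), which by assumption equals the bound for
   all Var(S_n). *)
move=> Y YF; apply: (@le_trans _ _ 'V_P[partial_sum Y 1]%E); last first.
  by apply: ereal_sup_ubound; exists 1%N.
apply: ge_ereal_sup => _ [n _ <-]; apply: (le_trans (varX n)).
rewrite -varX0 (has_df_variance (XF 0%N) F_mean) partial_sum1.
by rewrite (has_df_variance (YF 0%N) F_mean).
Qed.
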